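(* Let $m\ge1$ and $\mathfrak{g}_m=\mathfrak{sl}(2)\ltimes V(m)$, $\mathfrak{r}=V(m)$. Let $V=V(a_0)\oplus\cdots\oplus V(a_\ell)$ and $W=V(b_0)\oplus\cdots\oplus V(b_{\ell'})$ be the socle decompositions of two uniserial $\mathfrak{g}_m$-modules of type $Z$, and for $t\ge0$ let $S_t=\big(\bigoplus_{i+j=t}V(a_i)\otimes V(b_j)\big)^{\mathfrak{r}}$. Then $\mathrm{soc}(V\otimes W)=\mathrm{soc}(V)\otimes\mathrm{soc}(W)\oplus\bigoplus_{t=1}^{\min\{\ell,\ell'\}}S_t$, where, as $\mathfrak{sl}(2)$-modules, for $1\le t\le\min\{\ell,\ell'\}$: (i) If $V=Z(a_0,\ell)$ and $W=Z(b_0,\ell')$, then $S_t\cong V(a_0+b_0+mt)$, and hence $\mathrm{soc}(V\otimes W)\cong\bigoplus_{k=0}^{\min\{a_0,b_0\}}V(a_0+b_0-2k)\oplus\bigoplus_{t=1}^{\min\{\ell,\ell'\}}V(a_0+b_0+mt)$. (ii) If $V=Z(a_0,\ell)$ and $W=Z(b_{\ell'},\ell')^*$ (so $b_t=b_0-tm$), then $S_t=0$ if $a_0>b_t$ and $S_t\cong V(b_0-a_0-tm)$ if $a_0\le b_t$; hence $\mathrm{soc}(V\otimes W)\cong\bigoplus_{k=0}^{b_0}V(a_0-b_0+2k)$ if $a_0>b_0$, and $\mathrm{soc}(V\otimes W)\cong\bigoplus_{k=0}^{a_0}V(b_0-a_0+2k)\oplus\bigoplus_{t=1}^{T}V(b_0-a_0-tm)$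 if $a_0\le b_0$, where $T=\min\{\ell,\ell',\lfloor\frac{b_0-a_0}{m}\rfloor\}$. (iii) If $V=Z(a_\ell,\ell)^*$ and $W=Z(b_{\ell'},\ell')^*$, then $S_t=0$ for all $t\ge1$, and hence $\mathrm{soc}(V\otimes W)\cong\bigoplus_{k=0}^{\min\{a_0,b_0\}}V(|a_0-b_0|+2k)$. In particular, $\mathrm{soc}(V\otimes W)$ is multiplicity free as an $\mathfrak{sl}(2)$-module.
   Context: $\mathbb{F}$ is a field of characteristic zero; all modules are finite dimensional. $V(a)$ denotes the irreducible $\mathfrak{sl}(2)$-module of highest weight $a\ge0$. $\mathfrak{g}_m=\mathfrak{sl}(2)\ltimes V(m)$, where $\mathfrak{r}=V(m)$ is an abelian ideal with the adjoint $\mathfrak{sl}(2)$-action being that of $V(m)$. For integers $\alpha,\ell\ge0$, $Z(\alpha,\ell)$ is the uniserial $\mathfrak{g}_m$-module which as an $\mathfrak{sl}(2)$-module is $V(\alpha)\oplus V(\alpha+m)\oplus\cdots\oplus V(\alpha+\ell m)$, with $\mathfrak{r}V(\alpha)=0$ and with $\mathfrak{r}$ acting on $V(\alpha+im)$ ($1\le i\le\ell$) via a nonzero $\mathfrak{sl}(2)$-equivariant map $V(m)\otimes V(\alpha+im)\to V(\alpha+(i-1)m)$ (unique up to a scalar; the isomorphism class does not depend on the nonzero scalars chosen). Its socle decomposition is $V(\alpha)\oplus V(\alpha+m)\oplus\cdots\oplus V(\alpha+\ell m)$ in this order, and the socle decomposition of the dual $Z(\alpha,\ell)^*$ is $V(\alpha+\ell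 m)\oplus V(\alpha+(\ell-1)m)\oplus\cdots\oplus V(\alpha)$. Modules isomorphic to some $Z(\alpha,\ell)$ or $Z(\alpha,\ell)^*$ are said to be of type $Z$. In general, a socle decomposition of a uniserial module $V$ of composition length $\ell+1$ is a decomposition $V=V(a_0)\oplus\cdots\oplus V(a_\ell)$ into irreducible $\mathfrak{sl}(2)$-submodules with $\mathrm{soc}^k(V)=V(a_0)\oplus\cdots\oplus V(a_{k-1})$ for all $k$; $\mathrm{soc}$ denotes the socle (sum of irreducible submodules) and $U^{\mathfrak{r}}$ the vectors killed by $\mathfrak{r}$. *)

(* Defs.v *)
(* Finite-dimensional representations are modelled by
   matrices acting on ROW vectors of F^n (action  x . v := v *m rho x),
   subspaces by row spaces of square matrices (mxalgebra, %MS). *)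
From HB Require Import structures.
From mathcomp Require Import all_boot all_order all_algebra.
From mathcomp Require Import mxtens.
Set Implicit Arguments. Unset Strict Implicit. Unset Printing Implicit Defensive.
Import GRing.Theory.
Local Open Scope ring_scope.

Section Defs.
Variable F : fieldType.

(* Commutator.  With the row-vector convention a representation rho must
   satisfy rho [x,y] = lie (rho y) (rho x). *)
Definition lie n (A B : 'M[F]_n) : 'M[F]_n := A *m B - B *m A.

(* Action data of g_m = sl(2) |x V(m) on F^n : images of the standard basis
   e, f, h of sl(2) and of the basis x_0..x_m of r = V(m)
   (indices j > m of gX are required to be 0). *)
Record gact (m n : nat) := GAct {
  gE : 'M[F]_n; gF : 'M[F]_n; gH : 'M[F]_n; gX : nat -> 'M[F]_n }.

(* Brackets of g_m in the chosen basis (V(m) with the standard basis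
   h x_j = (m-2j) x_j, f x_j = x_{j+1}, e x_j = j(m-j+1) x_{j-1}):
   [h,e]=2e, [h,f]=-2f, [e,f]=h, [h,x_j]=(m-2j)x_j, [e,x_j]=j(m-j+1)x_{j-1},
   [f,x_j]=x_{j+1} (x_{m+1}=0), [x_i,x_j]=0. *)
Definition is_gmod m n (M : gact m n) : Prop :=
  [/\ lie (gE M) (gH M) = 2%:R *: gE M,
      lie (gF M) (gH M) = - (2%:R *: gF M),
      lie (gF M) (gE M) = gH M,
      (forall j, (m < j)%N -> gX M j = 0) &
      (forall i j, (j <= m)%N ->
         [/\ lie (gX M j) (gH M) = (m%:R - (2 * j)%:R) *: gX M j,
             lie (gX M j) (gE M) = (j * (m - j + 1))%:R *: gX M j.-1,
             lie (gX M j) (gF M) = gX M j.+1 &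
             lie (gX M j) (gX M i) = 0])].

Definition gdual m n (M : gact m n) : gact m n :=
  @GAct m n (- (gE M)^T) (- (gF M)^T) (- (gH M)^T) (fun j => - (gX M j)^T).

Definition gtens m n p (M : gact m n) (N : gact m p) : gact m (n * p) :=
  @GAct m (n * p) (gE M *t 1%:M + 1%:M *t gE N) (gF M *t 1%:M + 1%:M *t gF N)
       (gH M *t 1%:M + 1%:M *t gH N)
       (fun j => gX M j *t 1%:M + 1%:M *t gX N j).

(* The irreducible sl(2)-module V(a), basis v_0..v_a, row i = image of v_i:
   h v_i = (a-2i) v_i, f v_i = v_{i+1}, e v_i = i(a-i+1) v_{i-1}. *)
Definition stdH a : 'M[F]_a.+1 :=
  \matrix_(i, j) (if i == j then a%:R - (2 * i)%:R else 0).
Definition stdF a : 'M[F]_a.+1 :=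
  \matrix_(i, j) (if j == i.+1 :> nat then 1 else 0).
Definition stdE a : 'M[F]_a.+1 :=
  \matrix_(i, j) (if j.+1 == i :> nat then (i * (a - i + 1))%:R else 0).

Definition sl2_iso_irr m n (M : gact m n) (U : 'M[F]_n) (a : nat) : Prop :=
  exists B : 'M[F]_(a.+1, n),
    [/\ row_free B, (B == U)%MS,
        stdE a *m B = B *m gE M, stdF a *m B = B *m gF M &
        stdH a *m B = B *m gH M].

Definition sl2_iso_sum m n (M : gact m n) (U : 'M[F]_n) (s : seq nat) : Prop :=
  exists Us : 'I_(size s) -> 'M[F]_n,
    [/\ forall k, sl2_iso_irr M (Us k) (nth 0%N s k),
        (\sum_k Us k == U)%MS &
        \rank U = (\sum_k \rank (Us k))%N].

Definition gsub m n (M : gact m n) (U : 'M[F]_n) : Prop :=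
  [/\ stablemx U (gE M), stablemx U (gF M), stablemx U (gH M) &
      forall j, stablemx U (gX M j)].

Definition simple_over m n (M : gact m n) (S U : 'M[F]_n) : Prop :=
  [/\ gsub M S, gsub M U, (S < U)%MS &
      forall Y, gsub M Y -> (S <= Y)%MS -> (Y <= U)%MS ->
        (Y == S)%MS \/ (Y == U)%MS].

(* T / S = soc (M / S) : T is S plus the sum of all submodules U with
   U/S irreducible. *)
Definition rel_soc m n (M : gact m n) (S T : 'M[F]_n) : Prop :=
  [/\ gsub M T, (S <= T)%MS,
      (forall U, simple_over M S U -> (U <= T)%MS) &
      exists k (Us : 'I_k -> 'M[F]_n),
        (forall i, simple_over M S (Us i)) /\
        (T == S + \sum_i Us i)%MS].

Fixpoint is_sock m n (M : gact m n) (k : nat) (T : 'M[F]_n) : Prop :=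
  match k with
  | 0%N => (T == (0 : 'M[F]_n))%MS
  | k'.+1 => exists S : 'M[F]_n, is_sock M k' S /\ rel_soc M S T
  end.

Definition is_soc m n (M : gact m n) (T : 'M[F]_n) : Prop := is_sock M 1 T.

Definition socle_decomp m n (M : gact m n) (l : nat) (a : nat -> nat)
    (Vc : nat -> 'M[F]_n) : Prop :=
  [/\ forall i, (i <= l)%N -> sl2_iso_irr M (Vc i) (a i),
      (\sum_(i < l.+1) Vc i == 1%:M)%MS,
      \rank (1%:M : 'M[F]_n) = (\sum_(i < l.+1) \rank (Vc i))%N &
      forall k, (k <= l.+1)%N -> is_sock M k (\sum_(i < k) Vc i)%MS].

(* M is isomorphic to Z(alpha, l): as sl(2)-module M = W_0 (+) ... (+) W_l
   with W_i ~ V(alpha + i m), r W_0 = 0, and r acting on W_i (i >= 1) by a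
   nonzero (necessarily sl(2)-equivariant) map into W_{i-1}. *)
Definition isZ m n (M : gact m n) (alpha l : nat) : Prop :=
  exists Wc : nat -> 'M[F]_n,
    [/\ forall i, (i <= l)%N -> sl2_iso_irr M (Wc i) (alpha + i * m),
        (\sum_(i < l.+1) Wc i == 1%:M)%MS,
        \rank (1%:M : 'M[F]_n) = (\sum_(i < l.+1) \rank (Wc i))%N,
        forall j, Wc 0%N *m gX M j = 0 &
        forall i, (1 <= i <= l)%N ->
          (forall j, (Wc i *m gX M j <= Wc i.-1)%MS) /\
          exists j, (j <= m)%N /\ Wc i *m gX M j != 0].

Definition isZdual m n (M : gact m n) (alpha l : nat) : Prop :=
  isZ (gdual M) alpha l.

Definition typeZ m n (M : gact m n) : Prop :=
  exists alpha l, isZ M alpha l \/ isZdual M alpha l.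

Definition rinv m n (M : gact m n) (U : 'M[F]_n) : 'M[F]_n :=
  (U :&: \bigcap_(j < m.+1) kermx (gX M j))%MS.

Definition S_t m n p (V : gact m n) (W : gact m p) (l l' : nat)
    (Vc : nat -> 'M[F]_n) (Wc : nat -> 'M[F]_p) (t : nat) : 'M[F]_(n * p) :=
  rinv (gtens V W)
    (\sum_(i < l.+1) \sum_(j < l'.+1 | (i + j == t)%N) (Vc i *t Wc j))%MS.

End Defs.

(* Main.v *)
Require Import Defs.
From HB Require Import structures.
From mathcomp Require Import all_boot all_order all_algebra.
From mathcomp Require Import mxtens ring zify.
Import GRing.Theory.
Local Open Scope ring_scope.

(* Realise V(a) as binary forms of degree a. Up to scalars, r = V(m) then acts
   on Z(alpha, l) by constant-coefficient differential operators of order m,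
   and on Z(alpha, l)^* by multiplication with forms of degree m. Choosing
   monomial bases, a suitable multiple z_k of x_(m-k) shifts the index of a
   basis vector by k and its degree by one, with all coefficients 1, so for
   u of degree t in V (x) W being killed by r is a system of two-term
   relations between the coefficients y(i,s;j,r) of u, i + j = t.
   For Z (x) Z they say that (-1)^i y(i,s;j,r) depends on s + r only (a form of
   degree a_0 + b_0 + mt, polarised); for Z (x) Z^* that it is 0 when s > r and
   depends on r - s only otherwise (multiplication by a form of degree
   b_t - a_0); for Z^* (x) Z^* that u = 0, because p(x_1) u = -p(x_2) u' for all
   forms p of degree m forces u = u' = 0. When t > min(l, l') a term
   is missing from one of the relations and everything vanishes.
   As r lowers the degree, each nonzero submodule meets the r-invariants, so
   the socle of V (x) W is the sum of the S_t; S_0 is given by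
   Clebsch-Gordan, and multiplicities are controlled by Casimir eigenvalues. *)

Set Implicit Arguments. Unset Strict Implicit. Unset Printing Implicit Defensive.

(** * Highest weight vectors and the modules V(a) *)

(** Isomorphism types are pinned down by squeezing dimensions. A highest weight vector of weight c
    generates a copy of V(c) inside S_t, so the dimension is at least c + 1; solving the relations
    bounds it above by the same number. For a sum of irreducibles the copies are found one at a
    time, the Casimir element separates them because their weights are distinct, and a count of
    ranks shows that they fill the space. So multiplicity freeness is a tool here as well as a
    conclusion. The obstacle in solving the relations is the ends of the index ranges: the bound a_i
    moves with i, and a relation that pushes an index out of range loses a term. These boundary
    relations decide which coefficients vanish. The theorem speaks of an arbitrary socle
    decomposition, while the coefficients refer to a basis built from the definition of Z. The socle
    series depends on the module alone and its ranks give the a_i; these are distinct since m >= 1,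
    so the Casimir element also determines the components, and the two decompositions coincide. *)

Section CharZero.
Variable F : fieldType.
Hypothesis hchar : [pchar F] =i pred0.

Lemma natr_eq0 k : (k%:R == 0 :> F) = (k == 0)%N.
Proof. by have /pcharf0P -> := hchar. Qed.

Lemma natr_inj : injective (fun k : nat => k%:R : F).
Proof.
move=> i j /eqP; wlog le_ij : i j / (i <= j)%N => [hw|].
  case/orP: (leq_total i j) => [/hw//|/hw h]; by rewrite eq_sym => /h.
by rewrite eq_sym -subr_eq0 -natrB // natr_eq0 subn_eq0 => h; apply/eqP; rewrite eqn_leq le_ij.
Qed.

Section Eigen.
Variables (n : nat) (A : 'M[F]_n).

Lemma rank_sum_eigenvectors (I : finType) (lam : I -> F) (x : I -> 'rV[F]_n) :
  injective lam -> (forall i, x i *m A = lam i *: x i) ->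
  (forall i, x i != 0) -> \rank (\sum_i <<x i>>)%MS = #|I|.
Proof.
move=> lam_inj xA x_neq0.
have le_eig i : (<<x i>> <= eigenspace A (lam i))%MS.
  by rewrite genmxE; apply/eigenspaceP.
have /mxdirect_sumsP dxE : mxdirect (\sum_i eigenspace A (lam i)).
  by apply: mxdirect_sum_eigenspace => i j _ _; apply: lam_inj.
have /mxdirectP/= -> : mxdirect (\sum_i <<x i>>).
  apply/mxdirect_sumsP => i _; apply/eqP; rewrite -submx0 -[X in (_ <= X)%MS](dxE i isT) capmxS //.
  by apply: sumsmxS => j _.
rewrite -sum1_card; apply: eq_bigr => i _.
by rewrite mxrank_gen rank_rV x_neq0.
Qed.

Lemma row_free_eigenvectors k (B : 'M[F]_(k, n)) (lam : 'I_k -> F) :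
  injective lam -> (forall i, row i B *m A = lam i *: row i B) ->
  (forall i, row i B != 0) -> row_free B.
Proof.
move=> lam_inj BA B0; rewrite /row_free eqn_leq rank_leq_row /=.
rewrite -[X in (X <= _)%N]card_ord -(rank_sum_eigenvectors lam_inj BA B0).
by apply: mxrankS; apply/sumsmx_subP => i _; rewrite genmxE row_sub.
Qed.

End Eigen.

Section HighestWeight.
Variables (m n : nat) (M : gact F m n).
Hypothesis hM : is_gmod M.

Let hEH : gE M *m gH M = gH M *m gE M + 2%:R *: gE M.
Proof. by case: hM => <- *; rewrite /lie addrC subrK. Qed.
Let hFH : gF M *m gH M = gH M *m gF M - 2%:R *: gF M.
Proof. by case: hM => _ <- *; rewrite /lie addrC subrK. Qed.
Let hFE : gF M *m gE M = gE M *m gF M + gH M.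
Proof. by case: hM => _ _ <- *; rewrite /lie addrC subrK. Qed.

Variables (v : 'rV[F]_n) (D : nat).
Hypotheses (vE : v *m gE M = 0) (vH : v *m gH M = D%:R *: v).

Definition forbit s := iter s (fun u => u *m gF M) v.

Lemma forbitS s : forbit s.+1 = forbit s *m gF M.
Proof. by []. Qed.

Lemma forbitH s : forbit s *m gH M = (D%:R - (2 * s)%:R) *: forbit s.
Proof.
elim: s => [|s IHs]; first by rewrite muln0 subr0.
rewrite forbitS -mulmxA hFH mulmxBr mulmxA IHs -scalemxAl -scalemxAr -scalerBl.
by congr (_ *: _); ring.
Qed.

Lemma forbitE s :
  forbit s.+1 *m gE M = (s.+1%:R * (D%:R - s%:R)) *: forbit s.
Proof.
elim: s => [|s IHs].
  by rewrite /= -mulmxA hFE mulmxDr mulmxA vE mul0mx add0r vH subr0 mul1r.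
rewrite [forbit s.+2]forbitS -mulmxA hFE mulmxDr mulmxA IHs forbitH -scalemxAl.
by rewrite -forbitS -scalerDl; congr (_ *: _); ring.
Qed.

Hypothesis v_neq0 : v != 0.

Lemma forbit_neq0 s : (s <= D)%N -> forbit s != 0.
Proof.
elim: s => // s IHs lt_sD; apply/eqP => f0.
have := forbitE s; rewrite f0 mul0mx => /esym/eqP.
rewrite scaler_eq0 (negPf (IHs (ltnW lt_sD))) orbF mulf_eq0 natr_eq0 /=.
by rewrite subr_eq0 => /eqP/natr_inj/eqP; rewrite gtn_eqF.
Qed.

(* If [v F^(D+1)] were nonzero, applying [E] would show that all the
   [v F^(D+1+j)] are nonzero: infinitely many [H]-eigenvalues. *)
Lemma forbit_eq0 : forbit D.+1 = 0.
Proof.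
apply/eqP/negPn/negP => fD.
have nz j : forbit (D.+1 + j) != 0.
  elim: j => [|j IHj]; first by rewrite addn0.
  rewrite addnS; apply/eqP => f0.
  have := forbitE (D.+1 + j); rewrite f0 mul0mx => /esym/eqP.
  rewrite scaler_eq0 (negPf IHj) orbF mulf_eq0 natr_eq0 /=.
  rewrite subr_eq0 => /eqP/natr_inj/eqP; rewrite -[X in X == _]addn0.
  by rewrite addSnnS eqn_add2l.
have := rank_sum_eigenvectors (A := gH M) (I := 'I_n.+1)
  (lam := fun j => D%:R - (2 * (D.+1 + j))%:R) (x := fun j => forbit (D.+1 + j)).
rewrite card_ord => h.
have : (n.+1 <= n)%N; last by rewrite ltnn.
rewrite -[X in (X <= _)%N]h ?rank_leq_col //; last by move=> i; apply: forbitH.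
move=> i j /addrI/oppr_inj/natr_inj/eqP; rewrite !eqn_mul2l /= eqn_add2l => /eqP.
exact: val_inj.
Qed.

(** The vectors [forbit s], s <= D, are independent because h has distinct eigenvalues on them, and
    [forbit D.+1 = 0] makes the action on them that of the standard matrices. They lie in every
    f-stable space that contains v. *)
Lemma highest_weight_irr (T : 'M[F]_n) :
  (v <= T)%MS -> stablemx T (gF M) -> exists2 U, sl2_iso_irr M U D & (U <= T)%MS.
Proof.
move=> vT TF; pose B := \matrix_(i < D.+1) forbit i.
have rowB i : row i B = forbit i by rewrite rowK.
have actB (A : 'M_D.+1) i : row i (A *m B) = \sum_j A i j *: forbit j.
  by rewrite row_mul mulmx_sum_row; apply: eq_bigr => j _; rewrite rowB mxE.
exists <<B>>%MS; last first.
  rewrite genmxE; apply/row_subP => i; rewrite rowB; elim: (i : nat) => //= s IHs.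
  exact: submx_trans (submxMr _ IHs) TF.
exists B; split; last 3 first.
- apply/row_matrixP => i; rewrite actB row_mul rowB.
  case: i => [[|s] lt_s] /=.
    by rewrite vE big1 // => j _; rewrite mxE /= scale0r.
  rewrite -/(forbit s.+1) forbitE (bigD1 (Ordinal (ltnW lt_s))) //= big1 ?addr0 => [|j].
    by rewrite mxE /= eqxx addn1 subnSK // natrM natrB // -ltnS ltnW.
  by rewrite mxE /= eqSS -val_eqE /= => /negPf ->; rewrite scale0r.
- apply/row_matrixP => i; rewrite actB row_mul rowB -forbitS.
  have [lt_i|ge_i] := ltnP i D.
    rewrite (bigD1 (Ordinal (lt_i : i.+1 < D.+1)%N)) //= big1 ?addr0 => [|j].
      by rewrite mxE /= eqxx scale1r.
    by rewrite mxE -val_eqE /= => /negPf ->; rewrite scale0r.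
  have -> : i = D :> nat by apply/eqP; rewrite eqn_leq ge_i -ltnS ltn_ord.
  rewrite forbit_eq0 big1 // => j _; rewrite mxE.
  by rewrite ltn_eqF ?scale0r // (leq_trans (ltn_ord j)).
- apply/row_matrixP => i; rewrite actB row_mul rowB forbitH.
  rewrite (bigD1 i) //= big1 ?addr0 => [|j]; first by rewrite mxE eqxx.
  by rewrite mxE eq_sym => /negPf ->; rewrite scale0r.
- apply: (@row_free_eigenvectors _ (gH M) _ _ (fun i => D%:R - (2 * i)%:R)).
  + move=> i j /addrI/oppr_inj/natr_inj/eqP; rewrite eqn_mul2l /= => /eqP.
    exact: val_inj.
  + by move=> i; rewrite rowB forbitH.
  + by move=> i; rewrite rowB forbit_neq0 // -ltnS.
- by apply/eqmxP/eqmx_sym/genmxE.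
Qed.

End HighestWeight.

Section Irreducible.
Variables (m n : nat) (M : gact F m n).

Lemma sl2_iso_irr_rank U c : sl2_iso_irr M U c -> \rank U = c.+1.
Proof. by case=> B [/eqP rB /eqmxP <- _ _ _]. Qed.

Lemma sl2_iso_irr_eqmx U U' c : (U == U')%MS -> sl2_iso_irr M U c -> sl2_iso_irr M U' c.
Proof.
move=> /eqmxP UU' [B [fB /eqmxP BU hE hF hH]]; exists B; split=> //.
by apply/eqmxP; apply: eqmx_trans BU UU'.
Qed.

(** The copy of V(D) generated by v has rank D + 1, so the upper bound on the rank of T leaves room
    for nothing else. *)
Lemma highest_weight_iso (hM : is_gmod M) (v : 'rV_n) (D : nat) (T : 'M[F]_n) :
  v *m gE M = 0 -> v *m gH M = D%:R *: v -> v != 0 ->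
  (v <= T)%MS -> stablemx T (gF M) -> (\rank T <= D.+1)%N -> sl2_iso_irr M T D.
Proof.
move=> vE vH v0 vT TF rT; have [U hU UT] := highest_weight_irr hM vE vH v0 vT TF.
apply: (sl2_iso_irr_eqmx _ hU).
by rewrite -(mxrank_leqif_eq UT) eqn_leq mxrankS //= (sl2_iso_irr_rank hU).
Qed.

Lemma row_stdE a (x : 'rV[F]_a.+1) (s : 'I_a.+1) :
  (x *m stdE F a) 0 s = if (s < a)%N then x 0 (inord s.+1) * (s.+1 * (a - s))%:R else 0.
Proof.
rewrite mxE; case: ltnP => [lt_s|ge_s].
  rewrite (bigD1 (inord s.+1)) //= big1 ?addr0 => [|j].
    by rewrite mxE inordK // eqxx; congr (_ * _%:R); rewrite addn1 subnSK.
  rewrite mxE -val_eqE /= inordK // eq_sym => /negPf ->; exact: mulr0.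
rewrite big1 // => j _; rewrite mxE gtn_eqF ?mulr0 //.
by rewrite (leq_trans (ltn_ord j)).
Qed.

Lemma delta_stdE a (s : 'I_a.+1) :
  delta_mx 0 s *m stdE F a = (s * (a - s + 1))%:R *: delta_mx 0 (inord s.-1) :> 'rV_a.+1.
Proof.
rewrite -rowE; apply/rowP => j; rewrite !mxE eqxx /=; case: s => [[|s] lt_s] /=.
  by rewrite mul0r.
rewrite -val_eqE /= inordK ?(ltnW lt_s) // eqSS.
by case: eqP; rewrite ?mulr1 ?mulr0.
Qed.

Lemma delta_stdH a (s : 'I_a.+1) :
  delta_mx 0 s *m stdH F a = (a%:R - (2 * s)%:R) *: delta_mx 0 s :> 'rV_a.+1.
Proof.
rewrite -rowE; apply/rowP => j; rewrite !mxE eqxx /= eq_sym.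
by case: eqP; rewrite ?mulr1 ?mulr0.
Qed.

Lemma delta_stdF a (s : 'I_a.+1) :
  (s < a)%N -> delta_mx 0 s *m stdF F a = delta_mx 0 (inord s.+1) :> 'rV_a.+1.
Proof.
move=> lt_s; rewrite -rowE; apply/rowP => j; rewrite !mxE eqxx /=.
by rewrite -val_eqE /= inordK //; case: eqP.
Qed.

(** Repeated application of e drives a nonzero vector to a nonzero multiple of v_0 (induction on a
    bound k for its support), and f rebuilds the whole module from v_0. *)
Lemma std_irr a (P : 'M[F]_a.+1) :
  stablemx P (stdE F a) -> stablemx P (stdF F a) -> P != 0 -> row_full P.
Proof.
move=> PE PF /rowV0Pn[x xP x0].
have hw : ((delta_mx 0 0 : 'rV_a.+1) <= P)%MS.
  suff key k : forall y : 'rV_a.+1, (y <= P)%MS -> y != 0 ->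
    (forall j : 'I_a.+1, (k <= j)%N -> y 0 j = 0) -> ((delta_mx 0 0 : 'rV_a.+1) <= P)%MS.
    by apply: (key a.+1 x xP x0) => j; rewrite leqNgt ltn_ord.
  elim: k {x xP x0} => [|k IHk] x xP x0 hx.
    by case/eqP: x0; apply/rowP => j; rewrite mxE hx.
  have [xE|] := eqVneq (x *m stdE F a) 0; last first.
    move/IHk; apply=> [|j le_kj]; first exact: submx_trans (submxMr _ xP) PE.
    rewrite row_stdE; case: ifP => // lt_j.
    by rewrite hx ?mul0r // inordK.
  have x1 j : j != 0 -> x 0 j = 0.
    case: j => [[|j] lt_j] // _; have := congr1 (fun z : 'rV_a.+1 => z 0 (inord j)) xE.
    rewrite row_stdE mxE inordK // ?(ltnW lt_j) // (_ : (j < a)%N) //.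
    move/eqP; rewrite mulf_eq0 natr_eq0 muln_eq0 /= subn_eq0 leqNgt (_ : (j < a)%N) // orbF.
    by move/eqP; rewrite (_ : inord j.+1 = Ordinal lt_j) //; apply: val_inj; rewrite /= inordK.
  have xd : x = x 0 0 *: delta_mx 0 0.
    apply/rowP => j; rewrite !mxE eqxx /=; have [->|/x1 ->] := eqVneq j 0.
      by rewrite mulr1.
    by rewrite mulr0.
  have x00 : x 0 0 != 0 by apply: contraNneq x0 => x00; rewrite xd x00 scale0r.
  by rewrite -(eqmx_scale _ x00) -xd.
rewrite -sub1mx; apply/row_subP => i; rewrite row1.
case: i => i lt_i; elim: i lt_i => [|i IHi] lt_i.
  by rewrite (_ : Ordinal _ = 0) //; apply: val_inj.
have := submx_trans (submxMr (stdF F a) (IHi (ltnW lt_i))) PF.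
rewrite delta_stdF //= (_ : inord i.+1 = Ordinal lt_i) //.
by apply: val_inj; rewrite /= inordK.
Qed.

(* [B] identifies V(c) with a subspace; pulling [Y] back along [B] gives an
   sl(2)-submodule of V(c). *)
Lemma irr_sub c (B : 'M[F]_(c.+1, n)) (Y : 'M[F]_n) (x : 'rV_c.+1) :
  stdE F c *m B = B *m gE M -> stdF F c *m B = B *m gF M ->
  stablemx Y (gE M) -> stablemx Y (gF M) ->
  x != 0 -> (x *m B <= Y)%MS -> (B <= Y)%MS.
Proof.
move=> BE BF YE YF x0 xB; pose P := kermx (B *m cokermx Y).
have inP q (z : 'M_(q, _)) : (z <= P)%MS = (z *m B <= Y)%MS.
  by rewrite /P sub_kermx mulmxA submxE.
have PY : (P *m B <= Y)%MS by rewrite -inP.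
have fP : row_full P.
  apply: std_irr.
  - by rewrite inP -mulmxA BE mulmxA; apply: submx_trans (submxMr _ PY) YE.
  - by rewrite inP -mulmxA BF mulmxA; apply: submx_trans (submxMr _ PY) YF.
  - by apply/rowV0Pn; exists x => //; rewrite inP.
by rewrite -[B]mul1mx -inP submx_full.
Qed.

(** In the row convention [gE M *m gF M] is e followed by f, so this is 4fe + h^2 + 2h = 2(ef + fe)
    + h^2, a multiple of the Casimir element. It acts on V(c) by c(c + 2). *)
Definition casimir := 4%:R *: (gE M *m gF M) + gH M *m gH M + 2%:R *: gH M.

Lemma casimir_irr U c : sl2_iso_irr M U c ->
  U *m casimir = (c * c.+2)%:R *: U.
Proof.
case=> B [fB /eqmxP BU hE hF hH].
have /submxP[Q ->] : (U <= B)%MS by rewrite BU.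
rewrite -mulmxA scalemxAr; congr (_ *m _).
have -> : B *m casimir =
  (4%:R *: (stdE F c *m stdF F c) + stdH F c *m stdH F c + 2%:R *: stdH F c) *m B.
  rewrite /casimir !mulmxDr !mulmxDl -!scalemxAr -!scalemxAl -!mulmxA hF hH.
  by rewrite !mulmxA hE hH.
rewrite -[RHS]mul_scalar_mx; congr (_ *m _); apply/row_matrixP => s.
rewrite !rowE mul_mx_scalar !mulmxDr -!scalemxAr !mulmxA delta_stdE delta_stdH -!scalemxAl.
rewrite delta_stdH; case: s => [[|s] lt_s] /=.
  rewrite mul0n scale0r scaler0 add0r !scalerA -scalerDl; congr (_ *: _); ring.
rewrite delta_stdF inordK ?(ltnW lt_s) //.
rewrite (_ : inord s.+1 = Ordinal lt_s); last by apply: val_inj; rewrite /= inordK.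
rewrite !scalerA -!scalerDl; congr (_ *: _).
rewrite addn1 subnSK // natrM natrB; [ring | exact: ltnW].
Qed.

(** The map c -> c(c + 2) is injective on naturals, so copies of V(c) for distinct c lie in distinct
    Casimir eigenspaces and are independent; the rank bound then forces their sum to be T. *)
Lemma sl2_iso_sum_uniq (T : 'M[F]_n) (s : seq nat) : uniq s ->
  (forall c, c \in s -> exists2 U, sl2_iso_irr M U c & (U <= T)%MS) ->
  (\rank T <= \sum_(c <- s) c.+1)%N -> sl2_iso_sum M T s.
Proof.
move=> us hs rT.
have /fin_all_exists[Us hUs] (k : 'I_(size s)) :
  exists U, sl2_iso_irr M U (nth 0%N s k) /\ (U <= T)%MS.
  by have [|U] := hs (nth 0%N s k); [rewrite mem_nth | exists U].
pose lam (k : 'I_(size s)) : F := (nth 0 s k * (nth 0 s k).+2)%:R%N.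
have lam_inj : injective lam.
  move=> i j /natr_inj/eqP eq_ij; apply/val_inj/eqP.
  rewrite -(nth_uniq 0%N (ltn_ord i) (ltn_ord j) us).
  apply: contraTT eq_ij; rewrite neq_ltn => /orP[] lt_ij.
    by rewrite ltn_eqF // ltn_mul.
  by rewrite gtn_eqF // ltn_mul.
have Useig k : (Us k <= eigenspace casimir (lam k))%MS.
  by apply/eigenspaceP; rewrite (casimir_irr (hUs k).1).
have /mxdirect_sumsP dxE : mxdirect (\sum_k eigenspace casimir (lam k)).
  by apply: mxdirect_sum_eigenspace => i j _ _; apply: lam_inj.
have /mxdirectP/= rkU : mxdirect (\sum_k Us k).
  apply/mxdirect_sumsP => i _; apply/eqP.
  rewrite -submx0 -[X in (_ <= X)%MS](dxE i isT) capmxS //.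
  by apply: sumsmxS => j _.
have leUT : (\sum_k Us k <= T)%MS by apply/sumsmx_subP => k _; case: (hUs k).
have UT : (\sum_k Us k == T)%MS.
  rewrite -(mxrank_leqif_eq leUT) eqn_leq mxrankS //= rkU (leq_trans rT) //.
  rewrite (big_nth 0%N) big_mkord; apply: leq_sum => k _.
  by rewrite (sl2_iso_irr_rank (hUs k).1).
exists Us; split=> //; first by move=> k; case: (hUs k).
by rewrite -rkU; apply/eqP; rewrite eqn_leq !mxrankS // ?(eqmxP UT).
Qed.

End Irreducible.

End CharZero.

(** * Coefficients of r-invariant tensors *)

Section Coefficients.
Variables (F : fieldType) (m : nat).

(** [y i s j r] is the coefficient at (s-th monomial of degree i in V) (x) (r-th monomial of degree
    j in W). Total functions avoid index types depending on i and j; coefficients out of range are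
    required to be 0. *)
Definition coef := nat -> nat -> nat -> nat -> F.
Definition coef_swap (y : coef) : coef := fun j r i s => y i s j r.

Definition in_range l (a : nat -> nat) i s := (i <= l)%N && (s <= a i)%N.

(* The actions on the coefficients in the monomial bases: [zact] is that of the
   multiple [zop] of [x_(m-k)] below, [eact] that of [e], [hact] that of [h]. *)
Definition zact (d : bool) k i s (g : nat -> nat -> F) : F :=
  if d then (if (k <= s)%N then g i.+1 (s - k)%N else 0) else g i.+1 (s + k)%N.

Definition eact (d : bool) c s (g : nat -> F) : F :=
  if d then - ((c - s + 1)%:R * (if s is s'.+1 then g s' else 0))
  else (c - s)%:R * g s.+1.

Definition hact (d : bool) c s : F :=
  if d then (2 * s)%:R - c%:R else c%:R - (2 * s)%:R.

(* In all that follows a flag [d] is [false] for Z and [true] for Z^*: the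
   highest weights of the socle factors go up, resp. down, by [m]. *)
Definition chain (d : bool) l (a : nat -> nat) := forall i, (i <= l)%N ->
  (if d then a i + i * m = a 0 else a i = a 0 + i * m)%N.

Lemma chainS d l a i : chain d l a -> (i < l)%N ->
  (if d then a i = a i.+1 + m else a i.+1 = a i + m)%N.
Proof.
move=> ch lt_i; have := ch i (ltnW lt_i); have := ch i.+1 lt_i.
by case: d {ch}; rewrite mulSn; lia.
Qed.

(** Each coordinate of degree i + 1 is read off in degree i by some z_k. For Z an index up to a_i +
    m is the sum of one up to a_i and one up to m; for Z^* already z_0 works, as a_(i+1) <= a_i. *)
Lemma zact_surj d l a i s : chain d l a -> (i < l)%N -> (s <= a i.+1)%N ->
  exists s0 k, [/\ in_range l a i s0, (k <= m)%N & forall g, zact d k i s0 g = g i.+1 s].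
Proof.
move=> ch lt_i le_s; have := chainS ch lt_i; rewrite /in_range /zact (ltnW lt_i) /=.
case: d {ch} => e.
  by exists s, 0%N; split=> [|//|g]; [lia | rewrite leq0n subn0].
exists (minn s (a i)), (s - minn s (a i))%N; split=> [||g]; [lia | lia |].
by congr g; lia.
Qed.

Lemma zact_eq0 d k i s g : (forall s, g i.+1 s = 0) -> zact d k i s g = 0.
Proof. by move=> g0; rewrite /zact; case: d; [case: ifP|]; rewrite ?g0. Qed.

Section TwoChains.
Variables (d d' : bool) (l l' : nat) (a b : nat -> nat).

(** These are the coordinates of the elements of S_t: [adm_rel] is the coefficient at (i, s; j, r)
    of z_k u = 0, and it has content only for i + j + 1 = t. *)
Record admissible t (y : coef) : Prop := Admissible {
  adm_outl : forall i s j r, ~~ in_range l a i s -> y i s j r = 0;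
  adm_outr : forall i s j r, ~~ in_range l' b j r -> y i s j r = 0;
  adm_deg : forall i s j r, (i + j)%N != t -> y i s j r = 0;
  adm_rel : forall i s j r k, in_range l a i s -> in_range l' b j r -> (k <= m)%N ->
    zact d k i s (fun i' s' => y i' s' j r) + zact d' k j r (y i s) = 0 }.

Record hw_coef c (y : coef) : Prop := HwCoef {
  hw_neq0 : exists i s j r, y i s j r != 0;
  hw_E : forall i s j r, in_range l a i s -> in_range l' b j r ->
    eact d (a i) s (fun s' => y i s' j r) + eact d' (b j) r (y i s j) = 0;
  hw_H : forall i s j r, in_range l a i s -> in_range l' b j r ->
    (hact d (a i) s + hact d' (b j) r) * y i s j r = c%:R * y i s j r }.

(* The admissible coefficients of degree [t] form a space of dimension at most
   [c.+1] containing a highest weight vector of weight [c]. *)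
Definition irr_degree t c :=
  (exists Y : nat -> coef, forall y, admissible t y -> exists eta : nat -> F,
     forall i s j r, in_range l a i s -> in_range l' b j r ->
       y i s j r = \sum_(e < c.+1) eta e * Y e i s j r) /\
  (exists2 y, admissible t y & hw_coef c y).

Definition zero_degree t :=
  forall y, admissible t y -> forall i s j r, y i s j r = 0.

End TwoChains.

(** The flip of the tensor factors. It reduces Z^* (x) Z to Z (x) Z^*, and the range l < t to l' <
    t. *)
Lemma admissible_swap d d' l l' a b t y :
  admissible d d' l l' a b t y -> admissible d' d l' l b a t (coef_swap y).
Proof.
case=> ol or dg rl; rewrite /coef_swap; split=> [i s j r h|i s j r h|i s j r h|].
- exact: or.
- exact: ol.
- by apply: dg; rewrite addnC.
- by move=> i s j r k h h' hk; rewrite addrC; apply: rl.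
Qed.

Lemma zero_degree_swap d d' l l' a b t :
  zero_degree d d' l l' a b t -> zero_degree d' d l' l b a t.
Proof. by move=> z y /admissible_swap/z y0 i s j r; apply: y0. Qed.

Lemma irr_degree_swap d d' l l' a b t c :
  irr_degree d d' l l' a b t c -> irr_degree d' d l' l b a t c.
Proof.
case=> [[Y hY] [y ya [[i [s [j [r yn]]]] yE yH]]]; split.
  exists (fun e => coef_swap (Y e)) => z /admissible_swap/hY[eta hz].
  by exists eta => i' s' j' r' h h'; apply: hz.
exists (coef_swap y); first exact: admissible_swap.
split.
- by exists j, r, i, s.
- by move=> j' r' i' s' h h'; rewrite addrC; apply: yE.
- by move=> j' r' i' s' h h'; rewrite [hact _ _ _ + _]addrC; apply: yH.
Qed.

Section Propagation.
Variables (d d' : bool) (l l' : nat) (a b : nat -> nat) (t : nat) (y : coef).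
Hypotheses (cha : chain d l a) (chb : chain d' l' b).
Hypothesis adm : admissible d d' l l' a b t y.

(** By [zact_surj] each y(i+1, s; j, r) is the first term of some relation whose second term has
    degrees (i, j + 1), hence vanishes. *)
Lemma adm_up i j : (i <= l)%N -> (j <= l')%N ->
  (forall s r, y i s j.+1 r = 0) -> forall s r, y i.+1 s j r = 0.
Proof.
move=> le_i le_j y0 s r.
have [/andP[lt_i le_s]|/(adm_outl adm)//] := boolP (in_range l a i.+1 s).
have [rr|/(adm_outr adm)//] := boolP (in_range l' b j r).
have [s0 [k [h hk hz]]] := zact_surj cha lt_i le_s.
have z0 : zact d' k j r (y i s0) = 0 by apply: zact_eq0.
by have := adm_rel adm h rr hk; rewrite hz z0 addr0.
Qed.

End Propagation.

(** For i = 0 the partner degree j = t exceeds l', so these coefficients are 0; [adm_up] carries the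
    vanishing to all i. *)
Lemma zero_degree_gtr d d' l l' a b t : chain d l a -> (l' < t)%N ->
  zero_degree d d' l l' a b t.
Proof.
move=> cha lt_t y adm i s j r.
have [e|/(adm_deg adm)//] := eqVneq (i + j)%N t.
elim: i j e s r => [|i IHi] j e s r.
  by apply: (adm_outr adm); rewrite /in_range; lia.
have [|lt_i] := leqP i.+1 l; last by apply: (adm_outl adm); rewrite /in_range; lia.
have [le_j lt_i|lt_j _] := leqP j l'; last by apply: (adm_outr adm); rewrite /in_range; lia.
by apply: (adm_up cha adm) => // [|s' r']; [lia | apply: IHi; lia].
Qed.

Lemma zero_degree_gt d d' l l' a b t : chain d l a -> chain d' l' b ->
  (minn l l' < t)%N -> zero_degree d d' l l' a b t.
Proof.
move=> cha chb; rewrite gtn_min => /orP[] lt_t; last exact: zero_degree_gtr.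
by apply: zero_degree_swap; apply: zero_degree_gtr.
Qed.

Hypothesis hm : (1 <= m)%N.

(** Comparing z_0 with z_1 gives y(i+1, s; j, r) = y(i+1, s+1; j, r-1), where for r = 0 the right
    side is 0. The index s + 1 is legitimate in degree i because a_i = a_(i+1) + m with m >= 1. *)
Lemma zero_degree_dual l l' a b t : chain true l a -> chain true l' b -> (1 <= t)%N ->
  zero_degree true true l l' a b t.
Proof.
move=> cha chb t_gt0.
have [le_t|] := leqP t (minn l l'); last exact: zero_degree_gt.
move=> y adm.
suff key i j s r : (i + j).+1 = t -> y i.+1 s j r = 0 /\ y i s j.+1 r = 0.
  move=> i s j r; have [e|/(adm_deg adm)//] := eqVneq (i + j)%N t.
  case: i e => [|i] e; last by case: (key i j s r) => //; lia.
  by case: j e => [|j] e; [lia | case: (key 0%N j s r) => //; lia].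
move=> e; have ea := @chainS _ _ _ i cha; have eb := @chainS _ _ _ j chb.
have yg s' r' : y i.+1 s' j r' = - y i s' j.+1 r'.
  have [rs|ns] := boolP (in_range l a i s'); last first.
    rewrite !(adm_outl adm) ?oppr0 //; move: ns; rewrite /in_range; lia.
  have [rr|nr] := boolP (in_range l' b j r'); last first.
    rewrite !(adm_outr adm) ?oppr0 //; move: nr; rewrite /in_range; lia.
  have := adm_rel adm rs rr (leq0n m); rewrite /zact !leq0n !subn0.
  by move/eqP; rewrite addr_eq0 => /eqP.
suff yi : forall s, y i.+1 s j r = 0.
  by split=> //; apply: oppr_inj; rewrite oppr0 -yg.
elim: r {s} => [|r IHr] s.
  have [rs|/(adm_outl adm)//] := boolP (in_range l a i.+1 s).
  have rs' : in_range l a i s.+1 by move: rs; rewrite /in_range; lia.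
  have rr : in_range l' b j 0 by rewrite /in_range; lia.
  by have := adm_rel adm rs' rr hm; rewrite /zact /= subn1 addr0.
have [rs|/(adm_outl adm)//] := boolP (in_range l a i.+1 s).
have rs' : in_range l a i s.+1 by move: rs; rewrite /in_range; lia.
have [rr|/(adm_outr adm)//] := boolP (in_range l' b j r.+1).
have := adm_rel adm rs' rr hm; rewrite /zact /= !subn1 /=.
by move/eqP; rewrite addr_eq0 => /eqP ->; rewrite -yg IHr.
Qed.

(** * Z (x) Z^* : coefficients constant along diagonals *)

Section Toeplitz.
Variables (l l' : nat) (a b : nat -> nat) (t : nat).
Hypotheses (cha : chain false l a) (chb : chain true l' b).
Hypotheses (t_gt0 : (1 <= t)%N) (t_le : (t <= minn l l')%N).

Lemma toeplitz y : admissible false true l l' a b t y ->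
  exists2 eta : nat -> F, (forall e, (b t < a 0 + e)%N -> eta e = 0) &
    forall i s j r, in_range l a i s -> in_range l' b j r ->
      y i s j r = if ((i + j)%N == t) && (s <= r)%N then (-1) ^+ i * eta (r - s)%N else 0.
Proof.
move=> adm; have [t' et] : exists t', t = t'.+1 by exists t.-1; rewrite prednK.
have eb : (b t' = b t + m)%N by rewrite et; apply: (chainS chb); lia.
(* The relations of z_0 and z_1 at the degrees (0, t') fix the row i = 0: eliminating y 1 leaves a
   shift along the diagonals. *)
have rel0 s r : (s <= a 0)%N -> (r <= b t')%N -> y 1%N s t' r = - y 0%N s t r.
  move=> hs hr; have h1 : in_range l a 0 s by rewrite /in_range; lia.
  have h2 : in_range l' b t' r by rewrite /in_range; lia.
  have := adm_rel adm h1 h2 (leq0n m); rewrite /zact leq0n addn0 subn0 -et.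
  by move/eqP; rewrite addr_eq0 => /eqP.
have rel1 s r : (s <= a 0)%N -> (r <= b t')%N ->
    y 1%N s.+1 t' r = - (if r is r'.+1 then y 0%N s t r' else 0).
  move=> hs hr; have h1 : in_range l a 0 s by rewrite /in_range; lia.
  have h2 : in_range l' b t' r by rewrite /in_range; lia.
  have := adm_rel adm h1 h2 hm; rewrite /zact addn1 -et.
  by case: r hr h2 => [|r] _ _ /=; rewrite ?subn1 /= => /eqP; rewrite addr_eq0 => /eqP.
have shift s r : (s < a 0)%N -> (r < b t')%N -> y 0%N s.+1 t r.+1 = y 0%N s t r.
  by move=> hs hr; apply: oppr_inj; rewrite -rel0 // rel1 // ltnW.
have low s : (s < a 0)%N -> y 0%N s.+1 t 0%N = 0.
  by move=> hs; apply: oppr_inj; rewrite -rel0 // rel1 ?oppr0 // ltnW.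
have diag s e : (s <= a 0)%N -> (s + e <= (b t).+1)%N -> y 0%N s t (s + e)%N = y 0%N 0%N t e.
  elim: s => // s IHs hs he; rewrite addSn shift ?IHs //; lia.
(* Since b_t + 1 <= b_t', a diagonal can be followed one step past b_t, where the coefficient is 0.
   A diagonal with e > b_t - a_0 gets there before s exceeds a_0, so it vanishes. *)
have eta0 e : (b t < a 0 + e)%N -> y 0%N 0%N t e = 0.
  move=> he.
  have [e_gt|e_le] := ltnP (b t) e.
    by apply: (adm_outr adm); rewrite /in_range; lia.
  have e1 : ((b t).+1 - e <= a 0)%N by lia.
  have e2 : ((b t).+1 - e + e = (b t).+1)%N by lia.
  rewrite -(diag _ _ e1) e2 //.
  by apply: (adm_outr adm); rewrite /in_range; lia.
exists (fun e => y 0%N 0%N t e) => // i s j r hs hr; have [e|/(adm_deg adm)//] := eqVneq (i + j)%N t.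
elim: i j e s r hs hr => [|i IHi] j e s r hs hr /=.
  have {e} ej : j = t by []; subst j; rewrite mul1r.
  case: leqP => [le_s|].
    by rewrite -{1}(subnKC le_s) diag //; move: hs hr; rewrite /in_range; lia.
  elim: r s hs hr => [|r IHr] [|s] // hs hr lt_r.
    by apply: low; move: hs; rewrite /in_range; lia.
  rewrite shift; [|by move: hs; rewrite /in_range; lia|by move: hr; rewrite /in_range; lia].
  by apply: IHr => //; move: hs hr; rewrite /in_range; lia.
have [lt_i le_s] := andP hs; have := chainS cha lt_i.
have [le_j le_r] := andP hr; have ej : (i + j.+1)%N = t by lia.
have lt_j : (j.+1 <= l')%N by lia.
have := cha (ltnW lt_i); have := chb lt_j.
have le_t : (t <= l')%N by lia.
have := chb le_t; rewrite -[X in (_ + X * m)%N]ej mulnDl => bt bj ai eai.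
(* The splitting of s from [zact_surj]: the relation of z_k at (i, s0; j, r) expresses y(i+1, s; j,
   r) through y(i, s0; j+1, r-k), which lies on the same diagonal. *)
pose s0 := minn s (a i); pose k := (s - s0)%N.
have h0 : in_range l a i s0 by rewrite /in_range /s0; lia.
have hk : (k <= m)%N by rewrite /k /s0; lia.
have := adm_rel adm h0 hr hk; rewrite /zact (_ : (s0 + k)%N = s); last by rewrite /k /s0; lia.
move/eqP; rewrite addr_eq0 => /eqP ->; rewrite exprS mulN1r.
case: (leqP k r) => le_kr; last by rewrite oppr0 ifF // /k; apply/negP; lia.
have [hr'|] := boolP (in_range l' b j.+1 (r - k)).
  rewrite IHi // (_ : (s0 <= r - k) = (s <= r))%N; last by rewrite /k /s0; lia.
  rewrite (_ : r - k - s0 = r - s)%N; last by rewrite /k /s0; lia.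
  by rewrite /=; case: ifP => _; [rewrite mulNr | rewrite oppr0].
(* Past b_(j+1) the coefficient is 0, and so is [eta]: as b_(j+1) - a_i = b_t - a_0, the diagonal
   satisfies the bound of [eta0]. *)
move=> nr; rewrite (adm_outr adm _ _ nr) oppr0; case: ifP => // le_sr.
by rewrite eta0 ?mulr0 //; move: nr; rewrite /in_range /k /s0; lia.
Qed.

Lemma zero_degree_mixed : (b t < a 0)%N -> zero_degree false true l l' a b t.
Proof.
move=> lt_ba y adm i s j r; have [eta eta0 hy] := toeplitz adm.
have [hs|/(adm_outl adm)//] := boolP (in_range l a i s).
have [hr|/(adm_outr adm)//] := boolP (in_range l' b j r).
by rewrite hy // eta0 ?mulr0 ?if_same //; lia.
Qed.

Lemma irr_degree_mixed : (a 0 <= b t)%N ->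
  irr_degree false true l l' a b t (b t - a 0).
Proof.
move=> le_ab; split.
  exists (fun e i s j r => if (i + j == t)%N && (r == s + e)%N then (-1) ^+ i else 0).
  move=> y adm; have [eta eta0 hy] := toeplitz adm.
  exists eta => i s j r hs hr; rewrite hy //.
  have [_|_] /= := eqVneq (i + j)%N t; last first.
    by rewrite big1 // => e _; rewrite mulr0.
  have [le_sr|lt_rs] /= := leqP s r; last first.
    by rewrite big1 // => e _; rewrite ifF ?mulr0 //; apply/eqP; lia.
  have [lt_e|ge_e] := ltnP (r - s) (b t - a 0).+1.
    rewrite (bigD1 (Ordinal lt_e)) //= big1 ?addr0 => [|e]; last first.
      by rewrite -val_eqE /= => ne; rewrite ifF ?mulr0 //; apply/eqP; lia.
    by rewrite subnKC // eqxx mulrC.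
  rewrite eta0 ?mulr0 ?big1 // => [e _|]; last by lia.
  by rewrite ifF ?mulr0 //; apply/eqP; have := ltn_ord e; lia.
(* The diagonal r - s = e has weight 2e - (b_j - a_i) = 2e - c, so the highest weight vector has
   [eta] supported at e = c. *)
pose c := (b t - a 0)%N.
pose y i s j r : F := if [&& in_range l a i s, in_range l' b j r, i + j == t & r == s + c]%N
  then (-1) ^+ i else 0.
have level i j : (i + j = t)%N -> (b j = a i + c)%N.
  move=> e; have le_i : (i <= l)%N by lia.
  have le_j : (j <= l')%N by lia.
  have le_t : (t <= l')%N by lia.
  have bt := chb le_t; have bj := chb le_j; have ai := cha le_i.
  by move: bt; rewrite /c -[X in (_ + X * m)%N]e mulnDl; lia.
exists y; split.
- by move=> i s j r /negPf ns; rewrite /y ns.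
- by move=> i s j r /negPf nr; rewrite /y nr andbF.
- by move=> i s j r /negPf nt; rewrite /y nt !andbF.
- move=> i s j r k hs hr hk; rewrite /zact.
  have [et|nt] := eqVneq (i + j.+1)%N t; last first.
    have nt' : (i.+1 + j == t)%N = false by rewrite addSn -addnS; apply: negPf.
    rewrite /y nt' (negPf nt) !andbF.
    by rewrite if_same addr0.
  have [lt_i lt_j] : (i < l)%N /\ (j < l')%N by lia.
  have := chainS cha lt_i; have := chainS chb lt_j; have := level _ _ et => lv bj ai.
  have hs1 : in_range l a i.+1 (s + k) by move: hs; rewrite /in_range; lia.
  rewrite /y hs1 hr hs addSn -addnS et eqxx /=; case: (leqP k r) => le_kr; last first.
    by rewrite addr0 ifF //; apply/eqP; lia.
  have -> : (r == s + k + c)%N = (r - k == s + c)%N by lia.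
  have [rk|_] := eqVneq; last by rewrite andbF add0r.
  rewrite andbT ifT ?exprS ?mulN1r ?addNr //; move: hs; rewrite /in_range; lia.
- exists 0%N, 0%N, t, c; rewrite /y ifT ?expr0 ?oner_eq0 //.
  by rewrite !add0n !eqxx /in_range /c; lia.
- move=> i s j r hs hr; rewrite /eact.
  have [et|nt] := eqVneq (i + j)%N t; last first.
    by rewrite /y (negPf nt) !andbF mulr0; case: r {hr} => [|r]; rewrite /= ?andbF mulr0 oppr0 addr0.
  have lv := level _ _ et.
  have [er|nr] := eqVneq r (s.+1 + c)%N; last first.
    rewrite /y (negPf nr) !andbF mulr0 add0r; case: r hr nr => [|r] _; first by rewrite mulr0 oppr0.
    by rewrite addSn eqSS => /negPf ->; rewrite !andbF mulr0 oppr0.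
  have hs1 : in_range l a i s.+1 by move: hs hr; rewrite /in_range; lia.
  have hr1 : in_range l' b j (s + c) by move: hr; rewrite /in_range; lia.
  rewrite er /y hs hs1 -er hr er et /= addSn hr1 !eqxx /=.
  by apply/eqP; rewrite subr_eq0; apply/eqP; congr (_%:R * _); move: hs1; rewrite /in_range; lia.
- move=> i s j r hs hr; rewrite /y; case: ifP => [/and4P[_ _ /eqP/level lv /eqP ->]|]; last by rewrite !mulr0.
  by congr (_ * _); rewrite /hact lv !mulnDr !natrD; ring.
Qed.

End Toeplitz.

(** * Z (x) Z: coefficients constant along antidiagonals *)

Section Hankel.
Variables (l l' : nat) (a b : nat -> nat) (t : nat).
Hypotheses (cha : chain false l a) (chb : chain false l' b).
Hypotheses (t_gt0 : (1 <= t)%N) (t_le : (t <= minn l l')%N).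

Lemma hankel y : admissible false false l l' a b t y ->
  exists eta : nat -> F, forall i s j r, in_range l a i s -> in_range l' b j r ->
      y i s j r = if (i + j)%N == t then (-1) ^+ i * eta (s + r)%N else 0.
Proof.
move=> adm; have [t' et] : exists t', t = t'.+1 by exists t.-1; rewrite prednK.
have eb : (b t = b t' + m)%N by rewrite et; apply: (chainS chb); lia.
have rel0 s r k : (s <= a 0)%N -> (r <= b t')%N -> (k <= m)%N ->
    y 1%N (s + k)%N t' r = - y 0%N s t (r + k)%N.
  move=> hs hr hk; have h1 : in_range l a 0 s by rewrite /in_range; lia.
  have h2 : in_range l' b t' r by rewrite /in_range; lia.
  have := adm_rel adm h1 h2 hk; rewrite /zact -et.
  by move/eqP; rewrite addr_eq0 => /eqP.
have shift s r : (s < a 0)%N -> (r < b t)%N -> y 0%N s t r.+1 = y 0%N s.+1 t r.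
  (* With r = r0 + k and r0 <= b_t', both sides equal - y(1, s+k+1; t', r0): one by z_(k+1) at s,
     the other by z_k at s + 1. The bound k + 1 <= m comes from r < b_t = b_t' + m. *)
  move=> hs hr; apply: oppr_inj; pose r0 := minn r (b t'); pose k := (r - r0)%N.
  rewrite (_ : r.+1 = (r0 + k.+1)%N); last by rewrite /k /r0; lia.
  rewrite -rel0; [|lia|by rewrite /r0; lia|by rewrite /k /r0; lia].
  rewrite [X in _ = - y _ _ _ X](_ : r = (r0 + k)%N); last by rewrite /k /r0; lia.
  by rewrite -rel0 ?addnS ?addSn //; rewrite /k /r0; lia.
(* The antidiagonal s + r = e is represented by its entry with r as large as the range allows. *)
pose q e := minn e (b t); exists (fun e => y 0%N (e - q e)%N t (q e)).
have first_row s r : (s <= a 0)%N -> (r <= b t)%N ->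
  y 0%N s t r = y 0%N (s + r - q (s + r))%N t (q (s + r)%N).
  elim: s r => [|s IHs] r hs hr.
    by rewrite add0n /q (minn_idPl hr) subnn.
  have [->|ne] := eqVneq r (b t).
    by rewrite /q (minn_idPr _) ?leq_addl // addnK.
  have lt_r : (r < b t)%N by lia.
  by rewrite -shift // IHs ?addnS ?addSn // ltnW.
move=> i s j r hs hr; have [e|/(adm_deg adm)//] := eqVneq (i + j)%N t.
elim: i j e s r hs hr => [|i IHi] j e s r hs hr.
  have {e} ej : j = t by []; subst j; rewrite mul1r; apply: first_row.
    by case/andP: hs.
  by case/andP: hr.
have [lt_i le_s] := andP hs; have := chainS cha lt_i.
have [le_j le_r] := andP hr; have ej : (i + j.+1)%N = t by lia.
have lt_j : (j < l')%N by lia.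
have := chainS chb lt_j => bj eai.
pose s0 := minn s (a i); pose k := (s - s0)%N.
have h0 : in_range l a i s0 by rewrite /in_range /s0; lia.
have hk : (k <= m)%N by rewrite /k /s0; lia.
have := adm_rel adm h0 hr hk; rewrite /zact (_ : (s0 + k)%N = s); last by rewrite /k /s0; lia.
move/eqP; rewrite addr_eq0 => /eqP ->; rewrite exprS mulN1r mulNr.
have es : (s0 + (r + k) = s + r)%N by rewrite /k /s0; lia.
have hr1 : in_range l' b j.+1 (r + k) by rewrite /in_range; lia.
by rewrite (IHi _ ej _ _ h0 hr1) es.
Qed.

Lemma irr_degree_hankel : irr_degree false false l l' a b t (a 0 + b 0 + m * t).
Proof.
pose c := (a 0 + b 0 + m * t)%N.
have level i j : (i + j = t)%N -> (a i + b j = c)%N.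
  move=> e; have le_i : (i <= l)%N by lia.
  have le_j : (j <= l')%N by lia.
  have := chb le_j; have := cha le_i; rewrite /c -e mulnDr !(mulnC m); lia.
split.
  exists (fun e i s j r => if (i + j == t)%N && (s + r == e)%N then (-1) ^+ i else 0).
  move=> y adm; have [eta hy] := hankel adm.
  exists eta => i s j r hs hr; rewrite hy //.
  have [et|_] /= := eqVneq (i + j)%N t; last first.
    by rewrite big1 // => e _; rewrite mulr0.
  have lt_e : (s + r < c.+1)%N by have := level _ _ et; move: hs hr; rewrite /in_range; lia.
  rewrite (bigD1 (Ordinal lt_e)) //= big1 ?addr0 => [|e]; last first.
    by rewrite -val_eqE /= eq_sym => /negPf ->; rewrite mulr0.
  by rewrite eqxx mulrC.
(* This is the alternating sum of the tensors of highest weight vectors of degrees i and t - i: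
   [eta] is supported at 0. *)
pose y i s j r : F := if [&& in_range l a i s, in_range l' b j r, i + j == t & s + r == 0]%N
  then (-1) ^+ i else 0.
exists y; split.
- by move=> i s j r /negPf ns; rewrite /y ns.
- by move=> i s j r /negPf nr; rewrite /y nr andbF.
- by move=> i s j r /negPf nt; rewrite /y nt !andbF.
- move=> i s j r k hs hr hk; rewrite /zact.
  have [et|nt] := eqVneq (i + j.+1)%N t; last first.
    have nt' : (i.+1 + j == t)%N = false by rewrite addSn -addnS; apply: negPf.
    rewrite /y nt' (negPf nt) !andbF.
    by rewrite addr0.
  have [lt_i lt_j] : (i < l)%N /\ (j < l')%N by lia.
  have := chainS cha lt_i; have := chainS chb lt_j => bj ai.
  have hs1 : in_range l a i.+1 (s + k) by move: hs; rewrite /in_range; lia.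
  have hr1 : in_range l' b j.+1 (r + k) by move: hr; rewrite /in_range; lia.
  rewrite /y hs1 hr hs hr1 addSn -addnS et eqxx /= (_ : s + k + r = s + (r + k))%N; last by lia.
  by case: ifP; rewrite ?addr0 // exprS mulN1r addNr.
- exists 0%N, 0%N, t, 0%N; rewrite /y ifT ?expr0 ?oner_eq0 //.
  by rewrite !add0n !eqxx /in_range; lia.
- move=> i s j r hs hr; rewrite /eact /y !addSn !addnS /= !andbF !mulr0; exact: addr0.
- move=> i s j r hs hr; rewrite /y; case: ifP => [/and4P[_ _ /eqP/level lv]|]; last by rewrite !mulr0.
  rewrite addn_eq0 => /andP[/eqP -> /eqP ->].
  by congr (_ * _); rewrite -/c -lv /hact !muln0 !subr0 natrD.
Qed.

End Hankel.

End Coefficients.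

(** * Tensor products of matrices *)

Section TensorProduct.
Variable F : fieldType.

Lemma tensmxDl m n p q (A A' : 'M[F]_(m, n)) (B : 'M[F]_(p, q)) :
  (A + A') *t B = A *t B + A' *t B.
Proof. by apply/matrixP => i j; rewrite !mxE mulrDl. Qed.

Lemma tensmxDr m n p q (A : 'M[F]_(m, n)) (B B' : 'M[F]_(p, q)) :
  A *t (B + B') = A *t B + A *t B'.
Proof. by apply/matrixP => i j; rewrite !mxE mulrDr. Qed.

Lemma tensmxZl m n p q c (A : 'M[F]_(m, n)) (B : 'M[F]_(p, q)) :
  (c *: A) *t B = c *: (A *t B).
Proof. by apply/matrixP => i j; rewrite !mxE mulrA. Qed.

Lemma tensmxZr m n p q c (A : 'M[F]_(m, n)) (B : 'M[F]_(p, q)) :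
  A *t (c *: B) = c *: (A *t B).
Proof. by apply/matrixP => i j; rewrite !mxE mulrCA. Qed.

Lemma tensmx_suml m n p q (I : Type) (r : seq I) (P : pred I) (A : I -> 'M[F]_(m, n))
    (B : 'M[F]_(p, q)) :
  (\sum_(i <- r | P i) A i) *t B = \sum_(i <- r | P i) (A i *t B).
Proof.
by apply: (big_morph (fun A => A *t B)) => [A1 A2|]; rewrite ?tensmxDl ?tens0mx.
Qed.

Lemma tensmx_sumr m n p q (I : Type) (r : seq I) (P : pred I) (A : 'M[F]_(m, n))
    (B : I -> 'M[F]_(p, q)) :
  A *t (\sum_(i <- r | P i) B i) = \sum_(i <- r | P i) (A *t B i).
Proof.
by apply: (big_morph (fun B => A *t B)) => [B1 B2|]; rewrite ?tensmxDr ?tensmx0.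
Qed.

Lemma tensmx11 n p : (1%:M : 'M[F]_n) *t (1%:M : 'M[F]_p) = 1%:M.
Proof.
apply/matrixP => i j; case: (mxtens_indexP i) => i0 i1; case: (mxtens_indexP j) => j0 j1.
rewrite tensmxE !mxE (can_eq (@mxtens_indexK n p)) xpair_eqE.
by case: eqP; case: eqP; rewrite ?mulr1 ?mulr0 ?mul0r.
Qed.

Lemma tensmxS m m' n p q q' (A : 'M[F]_(m, n)) (A' : 'M[F]_(m', n))
    (B : 'M[F]_(p, q)) (B' : 'M[F]_(q', q)) :
  (A <= A')%MS -> (B <= B')%MS -> (A *t B <= A' *t B')%MS.
Proof. by move=> /submxP[C ->] /submxP[D ->]; rewrite -tensmx_mul submxMl. Qed.

Lemma row_free_tensmx m n p q (A : 'M[F]_(m, n)) (B : 'M[F]_(p, q)) :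
  row_free A -> row_free B -> row_free (A *t B).
Proof.
move=> /row_freeP[A' hA] /row_freeP[B' hB]; apply/row_freeP; exists (A' *t B').
by rewrite tensmx_mul hA hB tensmx11.
Qed.

Lemma mxrank_tensmx m n p q (A : 'M[F]_(m, n)) (B : 'M[F]_(p, q)) :
  \rank (A *t B) = (\rank A * \rank B)%N.
Proof.
have e : (A *t B :=: row_base A *t row_base B)%MS.
  by apply/eqmxP/andP; split; apply: tensmxS; rewrite eq_row_base.
by rewrite e; apply/eqP; apply: row_free_tensmx; apply: row_base_free.
Qed.

(** The tensor u as a bilinear form on coordinate functionals; operators on either factor then move
    to the functionals. *)
Definition tens_eval n p (u : 'rV[F]_(n * p)) (c : 'cV[F]_n) (c' : 'cV[F]_p) : F :=
  (u *m (c *t c')) 0 0.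

Section Pair.
Variables (n p : nat).
Implicit Types (u : 'rV[F]_(n * p)) (c : 'cV[F]_n) (d : 'cV[F]_p).

Lemma tens_evalZl u x c d : tens_eval u (x *: c) d = x * tens_eval u c d.
Proof. by rewrite /tens_eval tensmxZl -scalemxAr mxE. Qed.
Lemma tens_evalZr u x c d : tens_eval u c (x *: d) = x * tens_eval u c d.
Proof. by rewrite /tens_eval tensmxZr -scalemxAr mxE. Qed.
Lemma tens_eval0l u d : tens_eval u 0 d = 0.
Proof. by rewrite /tens_eval tens0mx mulmx0 mxE. Qed.
Lemma tens_eval0r u c : tens_eval u c 0 = 0.
Proof. by rewrite /tens_eval tensmx0 mulmx0 mxE. Qed.
Lemma tens_evalNl u c d : tens_eval u (- c) d = - tens_eval u c d.
Proof. by rewrite -scaleN1r tens_evalZl mulN1r. Qed.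
Lemma tens_evalNr u c d : tens_eval u c (- d) = - tens_eval u c d.
Proof. by rewrite -scaleN1r tens_evalZr mulN1r. Qed.

Lemma tens_eval_act u (A : 'M_n) (B : 'M_p) c d :
  tens_eval (u *m (A *t 1%:M + 1%:M *t B)) c d = tens_eval u (A *m c) d + tens_eval u c (B *m d).
Proof.
by rewrite /tens_eval -mulmxA mulmxDl !tensmx_mul !mul1mx mulmxDr mxE.
Qed.

Lemma tens_eval_tens (x : 'rV_n) (x' : 'rV_p) c d :
  tens_eval (x *t x') c d = (x *m c) 0 0 * (x' *m d) 0 0.
Proof.
rewrite /tens_eval (tensmx_mul x x' c d) mxE.
by rewrite (ord1 (mxtens_unindex _).1) (ord1 (mxtens_unindex _).2).
Qed.

End Pair.

Section Tens.
Variables (m n p : nat) (V : gact F m n) (W : gact F m p).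

Lemma lie_tens (A B : 'M[F]_n) (A' B' : 'M[F]_p) :
  lie (A *t 1%:M + 1%:M *t A') (B *t 1%:M + 1%:M *t B') =
  lie A B *t 1%:M + 1%:M *t lie A' B'.
Proof.
rewrite /lie !mulmxDl !mulmxDr !tensmx_mul !mul1mx !mulmx1 tensmxDl tensmxDr.
rewrite -!scaleN1r tensmxZl tensmxZr !scaleN1r.
move: (_ *t _) (_ *t _) (_ *t _) (_ *t _) (_ *t _) (_ *t _) => x1 x2 x3 x4 x5 x6.
by apply/matrixP => i j; rewrite !mxE; ring.
Qed.

Lemma gmod_tens : is_gmod V -> is_gmod W -> is_gmod (gtens V W).
Proof.
case=> vEH vFH vFE vX0 vX [wEH wFH wFE wX0 wX].
split; rewrite /= ?lie_tens.
- by rewrite vEH wEH tensmxZl tensmxZr scalerDr.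
- by rewrite vFH wFH -!scaleNr tensmxZl tensmxZr scalerDr.
- by rewrite vFE wFE.
- by move=> j hj; rewrite vX0 // wX0 // tens0mx tensmx0 addr0.
move=> i j hj; case: (vX i j hj) (wX i j hj) => [v1 v2 v3 v4] [w1 w2 w3 w4].
rewrite !lie_tens v1 v2 v3 v4 w1 w2 w3 w4; split=> //.
- by rewrite tensmxZl tensmxZr scalerDr.
- by rewrite tensmxZl tensmxZr scalerDr.
- by rewrite tens0mx tensmx0 addr0.
Qed.

End Tens.
End TensorProduct.

(** * Graded bases *)

Section GradedBasis.
Variable F : fieldType.

(* Normalised so that [zop M k] acts on monomial bases with coefficients 1. *)
Definition zop m n (M : gact F m n) k : 'M[F]_n :=
  ((-1) ^+ (m - k) * (k`!)%:R) *: gX M (m - k).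

(* [w i s] is the [s]-th monomial of degree [a i]; [ws] is the dual basis, as
   columns, extended by 0. The actions are given on [ws], since the coordinates
   [u *m ws i s] are what is used later. *)
Record graded_basis m n (M : gact F m n) (d : bool) l (a : nat -> nat)
    (Vc : nat -> 'M[F]_n) (w : nat -> nat -> 'rV[F]_n) (ws : nat -> nat -> 'cV[F]_n)
    : Prop := GradedBasis {
  gb_chain : chain m d l a;
  gb_irr : forall i, (i <= l)%N -> sl2_iso_irr M (Vc i) (a i);
  gb_span : forall i, (i <= l)%N -> (Vc i == \sum_(s < (a i).+1) <<w i s>>)%MS;
  gb_out : forall i s, ~~ in_range l a i s -> ws i s = 0;
  gb_dual : forall i s i' s', in_range l a i s -> in_range l a i' s' ->
    (w i s *m ws i' s') 0 0 = ((i == i') && (s == s'))%:R;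
  gb_id : \sum_(i < l.+1) \sum_(s < (a i).+1) ws i s *m w i s = 1%:M;
  gb_E : forall i s, in_range l a i s -> gE M *m ws i s =
    if d then - ((a i - s + 1)%:R *: (if s is s'.+1 then ws i s' else 0))
    else (a i - s)%:R *: ws i s.+1;
  gb_F : forall i s, in_range l a i s -> gF M *m ws i s =
    if d then - (s.+1%:R *: ws i s.+1)
    else s%:R *: ws i s.-1;
  gb_H : forall i s, in_range l a i s -> gH M *m ws i s = hact F d (a i) s *: ws i s;
  gb_Z : forall i s k, in_range l a i s -> (k <= m)%N -> zop M k *m ws i s =
    if d then (if (k <= s)%N then ws i.+1 (s - k)%N else 0) else ws i.+1 (s + k)%N }.

Lemma ord_in_range l a (i : 'I_l.+1) (s : 'I_(a (i : nat)).+1) : in_range l a i s.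
Proof. by rewrite /in_range !leq_ord. Qed.

Section OneModule.
Variables (m n : nat) (M : gact F m n) (d : bool) (l : nat) (a : nat -> nat).
Variables (Vc : nat -> 'M[F]_n) (w : nat -> nat -> 'rV[F]_n) (ws : nat -> nat -> 'cV[F]_n).
Hypothesis gb : graded_basis M d l a Vc w ws.

Lemma gb_w_sub i s : in_range l a i s -> (w i s <= Vc i)%MS.
Proof.
case/andP=> hi hs; rewrite (eqmxP (gb_span gb hi)).
by rewrite (sumsmx_sup (Ordinal (hs : s < (a i).+1)%N)) ?genmxE.
Qed.

Lemma gb_sub_coord i q (x : 'M_(q, n)) i' s : (i <= l)%N -> (x <= Vc i)%MS ->
  i != i' -> x *m ws i' s = 0.
Proof.
move=> hi; rewrite (eqmxP (gb_span gb hi)) => hx ne.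
have [hs|/(gb_out gb) ->] := boolP (in_range l a i' s); last by rewrite mulmx0.
apply/eqP; rewrite -sub_kermx; apply: submx_trans hx _.
apply/sumsmx_subP => r _; rewrite genmxE sub_kermx; apply/eqP.
apply/matrixP => x0 y0; rewrite !ord1 (gb_dual gb) ?(negPf ne) ?mxE //.
by rewrite /in_range hi leq_ord.
Qed.

Lemma gb_expand q (x : 'M_(q, n)) :
  x = \sum_(i < l.+1) \sum_(s < (a i).+1) (x *m ws i s) *m w i s.
Proof.
rewrite -[LHS]mulmx1 -(gb_id gb) mulmx_sumr; apply: eq_bigr => i _.
by rewrite mulmx_sumr; apply: eq_bigr => s _; rewrite mulmxA.
Qed.

End OneModule.

Lemma mul_mx11 q (x : 'M[F]_1) (z : 'rV_q) : x *m z = x 0 0 *: z.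
Proof. by rewrite {1}[x]mx11_scalar mul_scalar_mx. Qed.

Section TwoModules.
Variables (m n p : nat) (V : gact F m n) (W : gact F m p).
Hypotheses (hchar : [pchar F] =i pred0) (hm : (1 <= m)%N).
Hypotheses (hV : is_gmod V) (hW : is_gmod W).
Variables (d d' : bool) (l l' : nat) (a b : nat -> nat).
Variables (Vc : nat -> 'M[F]_n) (w : nat -> nat -> 'rV[F]_n) (ws : nat -> nat -> 'cV[F]_n).
Variables (Wc : nat -> 'M[F]_p) (v : nat -> nat -> 'rV[F]_p) (vs : nat -> nat -> 'cV[F]_p).
Hypotheses (gV : graded_basis V d l a Vc w ws) (gW : graded_basis W d' l' b Wc v vs).

Local Notation T := (gtens V W).

Definition coord (u : 'rV[F]_(n * p)) : coef F := fun i s j r => tens_eval u (ws i s) (vs j r).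

(** [x *t x'] has [1 * 1] rows; this retypes it as a row vector. *)
Definition rtens (x : 'rV[F]_n) (x' : 'rV[F]_p) : 'rV[F]_(n * p) := x *t x'.

Definition of_coord (y : coef F) : 'rV[F]_(n * p) :=
  \sum_(i < l.+1) \sum_(s < (a i).+1) \sum_(j < l'.+1) \sum_(r < (b j).+1)
    y i s j r *: rtens (w i s) (v j r).

Lemma of_coordK u : u = of_coord (coord u).
Proof.
rewrite -[LHS]mulmx1 -tensmx11 -(gb_id gV) -(gb_id gW) tensmx_suml mulmx_sumr.
apply: eq_bigr => i _; rewrite tensmx_suml mulmx_sumr; apply: eq_bigr => s _.
rewrite tensmx_sumr mulmx_sumr; apply: eq_bigr => j _.
rewrite tensmx_sumr mulmx_sumr; apply: eq_bigr => r _.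
rewrite -(tensmx_mul (ws i s) (vs j r) (w i s) (v j r)) mulmxA.
exact: (mul_mx11 (u *m (ws i s *t vs j r)) (rtens (w i s) (v j r))).
Qed.

Lemma coord_ext u u' : (forall i s j r, in_range l a i s -> in_range l' b j r ->
  coord u i s j r = coord u' i s j r) -> u = u'.
Proof.
move=> e; rewrite [u]of_coordK [u']of_coordK /of_coord.
apply: eq_bigr => i _; apply: eq_bigr => s _; apply: eq_bigr => j _; apply: eq_bigr => r _.
by congr (_ *: _); apply: e; apply: ord_in_range.
Qed.

Lemma coord_sum (I : Type) (r0 : seq I) (P : pred I) (f : I -> 'rV_(n * p)) i s j r :
  coord (\sum_(e <- r0 | P e) f e) i s j r = \sum_(e <- r0 | P e) coord (f e) i s j r.
Proof. by rewrite /coord /tens_eval mulmx_suml summxE. Qed.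

Lemma coordZ c u i s j r : coord (c *: u) i s j r = c * coord u i s j r.
Proof. by rewrite /coord /tens_eval -scalemxAl mxE. Qed.

Lemma coord_of_coord y i s j r : in_range l a i s -> in_range l' b j r ->
  coord (of_coord y) i s j r = y i s j r.
Proof.
move=> hs hr; have [hi hs'] := andP hs; have [hj hr'] := andP hr.
have rng i0 s0 : in_range l a (i0 : 'I_l.+1) (s0 : 'I_(a i0).+1).
  exact: ord_in_range.
have rng' i0 s0 : in_range l' b (i0 : 'I_l'.+1) (s0 : 'I_(b i0).+1).
  exact: ord_in_range.
rewrite /of_coord coord_sum (bigD1 (Ordinal (hi : i < l.+1)%N)) //= [X in _ + X]big1 ?addr0; last first.
  move=> i0 ne; rewrite coord_sum big1 // => s0 _; rewrite coord_sum big1 // => j0 _.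
  rewrite coord_sum big1 // => r0 _; rewrite coordZ /coord tens_eval_tens.
  have ne' : ((i0 : nat) == i) = false by apply: negPf.
  by rewrite (gb_dual gV) // ne' mul0r mulr0.
rewrite coord_sum (bigD1 (Ordinal (hs' : s < (a i).+1)%N)) //= [X in _ + X]big1 ?addr0; last first.
  move=> s0 ne; rewrite coord_sum big1 // => j0 _.
  rewrite coord_sum big1 // => r0 _; rewrite coordZ /coord tens_eval_tens.
  rewrite (gb_dual gV) //; last by rewrite /in_range hi leq_ord.
  have ne' : ((s0 : nat) == s) = false by apply: negPf.
  by rewrite ne' andbF mul0r mulr0.
rewrite coord_sum (bigD1 (Ordinal (hj : j < l'.+1)%N)) //= [X in _ + X]big1 ?addr0; last first.
  move=> j0 ne; rewrite coord_sum big1 // => r0 _; rewrite coordZ /coord tens_eval_tens.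
  have ne' : ((j0 : nat) == j) = false by apply: negPf.
  by rewrite (gb_dual gW) // ne' !mulr0.
rewrite coord_sum (bigD1 (Ordinal (hr' : r < (b j).+1)%N)) //= [X in _ + X]big1 ?addr0; last first.
  move=> r0 ne; rewrite coordZ /coord tens_eval_tens.
  rewrite (gb_dual gW) //; last by rewrite /in_range hj leq_ord.
  have ne' : ((r0 : nat) == r) = false by apply: negPf.
  by rewrite ne' andbF !mulr0.
by rewrite coordZ /coord tens_eval_tens (gb_dual gV) // (gb_dual gW) // !eqxx !mulr1.
Qed.

Definition degree_part t : 'M[F]_(n * p) :=
  (\sum_(i < l.+1) \sum_(j < l'.+1 | (i + j == t)%N) (Vc i *t Wc j))%MS.

Lemma degree_partP t u : reflect
  (forall i s j r, in_range l a i s -> in_range l' b j r -> (i + j)%N != t ->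
     coord u i s j r = 0) (u <= degree_part t)%MS.
Proof.
apply: (iffP idP) => [ut i s j r hs hr ne|hu].
  suff /eqP e : u *m (ws i s *t vs j r) == 0 by rewrite /coord /tens_eval e mxE.
  rewrite -sub_kermx; apply: submx_trans ut _.
  apply/sumsmx_subP => i0 _; apply/sumsmx_subP => j0 /eqP e.
  rewrite sub_kermx tensmx_mul; apply/eqP.
  have [ei|nei] := eqVneq (i0 : nat) i; last first.
    by rewrite (gb_sub_coord gV _ _ _ nei) ?tens0mx // leq_ord.
  have [ej|nej] := eqVneq (j0 : nat) j; last first.
    by rewrite (gb_sub_coord gW _ _ _ nej) ?tensmx0 // leq_ord.
  by case/eqP: ne; rewrite -ei -ej.
rewrite [u]of_coordK; apply: summx_sub => i _; apply: summx_sub => s _.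
apply: summx_sub => j _; apply: summx_sub => r _.
have hs : in_range l a i s by exact: ord_in_range.
have hr : in_range l' b j r by exact: ord_in_range.
have [e|ne] := eqVneq (i + j)%N t; last by rewrite hu // scale0r sub0mx.
rewrite scalemx_sub // (sumsmx_sup i) // (sumsmx_sup j) ?e //.
exact: (tensmxS (gb_w_sub gV hs) (gb_w_sub gW hr)).
Qed.

Lemma zop_tens k : zop T k = zop V k *t 1%:M + 1%:M *t zop W k.
Proof. by rewrite /zop scalerDr tensmxZl tensmxZr. Qed.

Lemma zop_ker q (N : gact F m q) (hN : is_gmod N) z (u : 'M_(z, q)) :
  (forall k, (k <= m)%N -> u *m zop N k = 0) -> forall j, u *m gX N j = 0.
Proof.
move=> h j; have [lt_mj|le_jm] := ltnP m j.
  by case: hN => _ _ _ -> //; rewrite mulmx0.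
have := h (m - j)%N (leq_subr _ _); rewrite /zop subKn // -scalemxAr => /eqP.
rewrite scaler_eq0 mulf_eq0 signr_eq0 natr_eq0 // => /orP[|/eqP//].
by rewrite eqn0Ngt fact_gt0.
Qed.

Lemma rinvP q (N : gact F m q) (hN : is_gmod N) (U : 'M_q) z (u : 'M_(z, q)) : reflect
  ((u <= U)%MS /\ forall k, (k <= m)%N -> u *m zop N k = 0) (u <= rinv N U)%MS.
Proof.
rewrite sub_capmx; apply: (iffP andP) => [[uU /sub_bigcapmxP h]|[uU h]]; split=> //.
  move=> k hk; rewrite /zop -scalemxAr.
  have /sub_kermxP -> : (u <= kermx (gX N (m - k)))%MS.
    by apply: (h (Ordinal (leq_subr k m : m - k < m.+1)%N)).
  by rewrite scaler0.
by apply/sub_bigcapmxP => j _; apply/sub_kermxP; apply: zop_ker.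
Qed.

Lemma coord_outl u i s j r : ~~ in_range l a i s -> coord u i s j r = 0.
Proof. by move=> h; rewrite /coord (gb_out gV h) tens_eval0l. Qed.

Lemma coord_outr u i s j r : ~~ in_range l' b j r -> coord u i s j r = 0.
Proof. by move=> h; rewrite /coord (gb_out gW h) tens_eval0r. Qed.

Lemma coord_zop u k i s j r : (k <= m)%N -> in_range l a i s -> in_range l' b j r ->
  coord (u *m zop T k) i s j r =
  zact d k i s (fun i' s' => coord u i' s' j r) + zact d' k j r (coord u i s).
Proof.
move=> hk hs hr; rewrite /coord zop_tens tens_eval_act (gb_Z gV) // (gb_Z gW) // /zact.
by congr (_ + _); [case: (d); [case: ifP; rewrite ?tens_eval0l|] | case: (d'); [case: ifP; rewrite ?tens_eval0r|]].
Qed.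

Lemma coord_gE u i s j r : in_range l a i s -> in_range l' b j r ->
  coord (u *m gE T) i s j r =
  eact d (a i) s (fun s' => coord u i s' j r) + eact d' (b j) r (coord u i s j).
Proof.
move=> hs hr; rewrite /coord tens_eval_act (gb_E gV) // (gb_E gW) // /eact.
congr (_ + _).
  by case: (d); rewrite ?tens_evalNl tens_evalZl //; case: s {hs} => [|s]; rewrite ?tens_eval0l.
by case: (d'); rewrite ?tens_evalNr tens_evalZr //; case: r {hr} => [|r]; rewrite ?tens_eval0r.
Qed.

Lemma coord_gH u i s j r : in_range l a i s -> in_range l' b j r ->
  coord (u *m gH T) i s j r = (hact F d (a i) s + hact F d' (b j) r) * coord u i s j r.
Proof.
by move=> hs hr; rewrite /coord tens_eval_act (gb_H gV) // (gb_H gW) // tens_evalZl tens_evalZr mulrDl.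
Qed.

Lemma coord_gF_eq0 u i s j r : in_range l a i s -> in_range l' b j r ->
  (forall s' r', coord u i s' j r' = 0) -> coord (u *m gF T) i s j r = 0.
Proof.
move=> hs hr h; rewrite /coord tens_eval_act (gb_F gV) // (gb_F gW) //.
by case: (d); case: (d'); rewrite ?tens_evalNl ?tens_evalNr tens_evalZl tens_evalZr -!/(coord _ _ _ _ _) !h !mulr0 ?oppr0 addr0.
Qed.

Lemma S_t_admissible t u :
  (u <= S_t V W l l' Vc Wc t)%MS <-> admissible m d d' l l' a b t (coord u).
Proof.
have hT := gmod_tens hV hW; split.
  case/(rinvP hT) => /degree_partP hu hz; split.
  - exact: coord_outl.
  - exact: coord_outr.
  - move=> i s j r ne; have [hs|/(coord_outl u)//] := boolP (in_range l a i s).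
    have [hr|/(coord_outr u)//] := boolP (in_range l' b j r).
    exact: hu.
  - move=> i s j r k hs hr hk; rewrite -coord_zop // hz // /coord /tens_eval mul0mx mxE //.
case=> _ _ dg rl; apply/(rinvP hT); split; first by apply/degree_partP => *; apply: dg.
move=> k hk; apply: coord_ext => i s j r hs hr.
by rewrite coord_zop // rl // /coord /tens_eval mul0mx mxE.
Qed.

Lemma S_t_zero t : zero_degree F m d d' l l' a b t ->
  (S_t V W l l' Vc Wc t == (0 : 'M_(n * p)))%MS.
Proof.
move=> z; rewrite sub0mx andbT; apply/row_subP => i.
suff -> : row i (S_t V W l l' Vc Wc t) = 0 by rewrite sub0mx.
have /S_t_admissible/z z0 := row_sub i (S_t V W l l' Vc Wc t).
by apply: coord_ext => *; rewrite z0 /coord /tens_eval mul0mx mxE.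
Qed.

Lemma stablemx_rows q (U : 'M[F]_q) (A : 'M_q) :
  (forall u : 'rV_q, (u <= U)%MS -> (u *m A <= U)%MS) -> stablemx U A.
Proof.
by move=> h; apply/row_subP => i; rewrite row_mul; apply/h/row_sub.
Qed.

Lemma degree_part_gF t : stablemx (degree_part t) (gF T).
Proof.
apply: stablemx_rows => u /degree_partP hu; apply/degree_partP => i s j r hs hr ne.
apply: coord_gF_eq0 => // s' r'.
have [h|/(coord_outl u)//] := boolP (in_range l a i s').
by have [h'|/(coord_outr u)//] := boolP (in_range l' b j r'); apply: hu.
Qed.

(** As [f, x_j] = x_(j+1) lies in r again, f u is killed by r whenever u is. *)
Lemma rinv_gF q (N : gact F m q) (hN : is_gmod N) (U : 'M_q) :
  stablemx U (gF N) -> stablemx (rinv N U) (gF N).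
Proof.
move=> UF; have /(rinvP hN)[inU hz] := submx_refl (rinv N U).
apply/(rinvP hN); split; first exact: submx_trans (submxMr _ inU) UF.
have h0 := zop_ker hN hz.
move=> k hk; rewrite /zop -scalemxAr -mulmxA.
have [_ _ _ _ hX] := hN; have [_ _ e _] := hX 0%N (m - k)%N (leq_subr _ _).
have -> : gF N *m gX N (m - k) = gX N (m - k) *m gF N - gX N (m - k).+1.
  by rewrite -e /lie opprB addrC subrK.
by rewrite mulmxBr mulmxA !h0 mul0mx subr0 scaler0.
Qed.

Lemma S_t_irr t c : irr_degree F m d d' l l' a b t c ->
  sl2_iso_irr T (S_t V W l l' Vc Wc t) c.
Proof.
case=> [[Y hY] [y ya [[i [s [j [r yn0]]]] yE yH]]]; have hT := gmod_tens hV hW.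
have y_eq i0 s0 j0 r0 : coord (of_coord y) i0 s0 j0 r0 = y i0 s0 j0 r0.
  have [h|h] := boolP (in_range l a i0 s0); last by rewrite (coord_outl _ _ _ h) (adm_outl ya).
  have [h'|h'] := boolP (in_range l' b j0 r0); last by rewrite (coord_outr _ _ _ h') (adm_outr ya).
  exact: coord_of_coord.
apply: (highest_weight_iso hchar hT (v := of_coord y)).
- apply: coord_ext => i0 s0 j0 r0 h h'; rewrite coord_gE //.
  rewrite [RHS]/coord /tens_eval mul0mx mxE -[RHS](yE _ _ _ _ h h') /eact.
  by congr (_ + _); [case: (d); case: (s0) | case: (d'); case: (r0)] => *; rewrite ?y_eq.
- apply: coord_ext => i0 s0 j0 r0 h h'; rewrite coord_gH // coordZ !y_eq; exact: yH.
- by apply: contraNneq yn0 => e; rewrite -y_eq e /coord /tens_eval mul0mx mxE.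
- apply/S_t_admissible; case: ya => ol or dg rl; split=> i0 s0 j0 r0.
  + by move=> h; rewrite y_eq ol.
  + by move=> h; rewrite y_eq or.
  + by move=> h; rewrite y_eq dg.
  + by move=> k h h' hk; rewrite -(rl _ _ _ _ _ h h' hk) /zact !y_eq.
- by apply: rinv_gF => //; apply: degree_part_gF.
- apply: leq_trans (_ : (\rank (\sum_(e < c.+1) <<of_coord (Y e)>>)%MS <= _)%N); last first.
    rewrite (leq_trans (mxrank_sum_leqif _)) //=.
    rewrite -[X in (_ <= X)%N]card_ord -sum1_card leq_sum // => e _.
    by rewrite mxrank_gen rank_leq_row.
  apply: mxrankS; apply/row_subP => q.
  have /S_t_admissible/hY[eta hq] := row_sub q (S_t V W l l' Vc Wc t).
  have -> : row q (S_t V W l l' Vc Wc t) = \sum_(e < c.+1) eta e *: of_coord (Y e).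
    apply: coord_ext => i0 s0 j0 r0 h h'; rewrite hq // coord_sum.
    by apply: eq_bigr => e _; rewrite coordZ coord_of_coord.
  by apply: summx_sub => e _; rewrite scalemx_sub // (sumsmx_sup e) ?genmxE.
Qed.

End TwoModules.
End GradedBasis.

(** * The Clebsch-Gordan decomposition *)

Section ClebschGordan.
Variable F : fieldType.
Hypothesis hchar : [pchar F] =i pred0.
Variables (m n p : nat) (V : gact F m n) (W : gact F m p).
Hypotheses (hV : is_gmod V) (hW : is_gmod W).
Local Notation T := (gtens V W).

Lemma rtens_act (x : 'rV_n) (x' : 'rV_p) (A : 'M[F]_n) (B : 'M_p) :
  rtens x x' *m (A *t 1%:M + 1%:M *t B) = rtens (x *m A) x' + rtens x (x' *m B).
Proof.
by rewrite /rtens mulmxDr (tensmx_mul x x' A 1%:M) (tensmx_mul x x' 1%:M B) !mulmx1.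
Qed.

Lemma rtensZl c (x : 'rV[F]_n) (x' : 'rV[F]_p) : rtens (c *: x) x' = c *: rtens x x'.
Proof. by apply/rowP => i; rewrite !mxE mulrA. Qed.
Lemma rtensZr c (x : 'rV[F]_n) (x' : 'rV[F]_p) : rtens x (c *: x') = c *: rtens x x'.
Proof. by apply/rowP => i; rewrite !mxE mulrCA. Qed.

Lemma tens_eval_rtens (x : 'rV[F]_n) (x' : 'rV[F]_p) c d :
  tens_eval (rtens x x') c d = (x *m c) 0 0 * (x' *m d) 0 0.
Proof. exact: tens_eval_tens. Qed.
Lemma tens_evalZu c (u : 'rV[F]_(n * p)) (x : 'cV_n) (y : 'cV_p) :
  tens_eval (c *: u) x y = c * tens_eval u x y.
Proof. by rewrite /tens_eval -scalemxAl mxE. Qed.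
Lemma tens_eval_sumu (I : Type) (r : seq I) (P : pred I) (f : I -> 'rV[F]_(n * p)) x y :
  tens_eval (\sum_(e <- r | P e) f e) x y = \sum_(e <- r | P e) tens_eval (f e) x y.
Proof. by rewrite /tens_eval mulmx_suml summxE. Qed.

Lemma stable_tensmx (A : 'M_n) (B : 'M_p) (f : 'M[F]_n) (g : 'M[F]_p) :
  stablemx A f -> stablemx B g -> stablemx (A *t B) (f *t 1%:M + 1%:M *t g).
Proof.
move=> Af Bg; rewrite mulmxDr !tensmx_mul !mulmx1 addmx_sub //.
  exact: tensmxS.
exact: tensmxS.
Qed.

Lemma sl2_iso_irr_stable N q (M : gact F N q) (U : 'M_q) c : sl2_iso_irr M U c ->
  [/\ stablemx U (gE M), stablemx U (gF M) & stablemx U (gH M)].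
Proof.
case=> B [_ /eqmxP BU hE hF hH].
by split; rewrite -!(eqmxMr _ BU) -BU -?hE -?hF -?hH submxMl.
Qed.

Lemma irr_basis N q (M : gact F N q) (U : 'M_q) c : sl2_iso_irr M U c ->
  exists (x : nat -> 'rV_q) (xs : nat -> 'cV_q), forall s, (s <= c)%N ->
    [/\ x s *m gE M = (s * (c - s + 1))%:R *: x s.-1,
        x s *m gH M = (c%:R - (2 * s)%:R) *: x s,
        (x s <= U)%MS &
        forall r, (r <= c)%N -> (x s *m xs r) 0 0 = (s == r)%:R].
Proof.
case=> B [/mulmxVp BB /eqmxP BU hE _ hH].
exists (fun s => row (inord s) B), (fun s => col (inord s) (pinvmx B)) => s hs.
have rowd i : row i B = delta_mx 0 i *m B by rewrite rowE.
split.
- rewrite rowd -mulmxA -hE mulmxA delta_stdE -scalemxAl rowd inordK //.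
- by rewrite rowd -mulmxA -hH mulmxA delta_stdH -scalemxAl inordK.
- by rewrite -BU row_sub.
- move=> r hr; have := congr1 (fun A : 'M_c.+1 => A (inord s) (inord r)) BB.
  rewrite !mxE -val_eqE /= !inordK // => <-.
  by apply: eq_bigr => i _; rewrite !mxE.
Qed.

Lemma clebsch_gordan (A : 'M_n) (B : 'M_p) a b k :
  sl2_iso_irr V A a -> sl2_iso_irr W B b -> (k <= minn a b)%N ->
  exists2 U, sl2_iso_irr T U (a + b - 2 * k) & (U <= A *t B)%MS.
Proof.
move=> hA hB hk; have hT := gmod_tens hV hW.
have [x [xs hx]] := irr_basis hA; have [y [ys hy]] := irr_basis hB.
(* The condition e h = 0 is the recursion (s+1)(a-s) g(s+1) = -(k-s)(b-k+s+1) g(s); g is its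
   solution, scaled to be integral. *)
pose g s : F := (-1) ^+ s * ((a - s)`! * (b - (k - s))`! * 'C(k, s))%:R.
pose h : 'rV[F]_(n * p) := \sum_(s < k.+1) g s *: rtens (x s) (y (k - s)%N).
have [ka kb] : (k <= a)%N /\ (k <= b)%N by lia.
have lek (s : 'I_k.+1) : (s <= k)%N := leq_ord s.
apply: (highest_weight_irr hchar hT (v := h)).
- rewrite mulmx_suml.
  under eq_bigr => s _.
    have [xE _ _ _] := hx s (leq_trans (lek s) ka).
    have [yE _ _ _] := hy (k - s)%N (leq_trans (leq_subr s k) kb).
    rewrite -scalemxAl rtens_act xE yE rtensZl rtensZr scalerDr !scalerA; over.
  (* The term s + 1 of the first sum and the term s of the second are multiples of the same tensor;
     the two unmatched end terms have coefficient 0. *)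
  rewrite big_split /= big_ord_recl /= mul0n mulr0 scale0r add0r.
  rewrite [X in _ + X]big_ord_recr /= subnn mul0n mulr0 scale0r addr0 -big_split /=.
  rewrite big1 // => s _; rewrite /bump /= add1n add0n (subnS k s) -scalerDl.
  have lt_s := ltn_ord s; apply/eqP; rewrite scaler_eq0; apply/orP; left; apply/eqP.
  have -> : (a - s.+1 + 1 = a - s)%N by lia.
  rewrite /g exprS mulN1r mulNr -mulrA -natrM mulNr -mulrA -natrM addrC; apply/eqP.
  rewrite subr_eq0; apply/eqP; congr (_ * _%:R).
  have -> : ((a - s)`! = (a - s) * (a - s.+1)`!)%N.
    by rewrite (_ : a - s = (a - s.+1).+1)%N ?factS //; lia.
  have -> : (b - (k - s.+1) = (b - (k - s)).+1)%N by lia.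
  rewrite factS addn1.
  move: (mul_bin_left k s); move: (a - s.+1)`! (b - (k - s))`! 'C(k, s.+1) 'C(k, s).
  move: (a - s)%N (k - s)%N (b - (k - s))%N => u z q f1 f2 c1 c2 e.
  symmetry; transitivity (u * f1 * f2 * q.+1 * (s.+1 * c1))%N; first by ring.
  by rewrite e; ring.
- rewrite mulmx_suml scaler_sumr; apply: eq_bigr => s _.
  have [_ xH _ _] := hx s (leq_trans (lek s) ka).
  have [_ yH _ _] := hy (k - s)%N (leq_trans (leq_subr s k) kb).
  rewrite -scalemxAl rtens_act xH yH rtensZl rtensZr -scalerDl !scalerA [X in _ = X *: _]mulrC.
  congr (_ * _ *: _).
  have := lek s => hs; rewrite !natrB ?natrD ?natrM ?natrB //; [ring | lia].
- have [_ _ _ x0] := hx 0%N isT; have [_ _ _ yk] := hy k kb.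
  have : tens_eval h (xs 0%N) (ys k) = g 0%N.
    rewrite /h tens_eval_sumu big_ord_recl subn0 big1 => [|s _].
      by rewrite tens_evalZu tens_eval_rtens x0 // yk // !eqxx !mulr1 addr0.
    have [|_ _ _ xs0] := hx (lift ord0 s); first exact: leq_trans (lek _) ka.
    by rewrite tens_evalZu tens_eval_rtens xs0 // mul0r mulr0.
  move=> e; apply/eqP => h0; move/eqP: e; rewrite h0 /tens_eval mul0mx mxE eq_sym /g mul1r.
  by rewrite (natr_eq0 hchar) !muln_eq0 bin0 !eqn0Ngt !fact_gt0.
- apply: summx_sub => s _; rewrite scalemx_sub //.
  have [_ _ xA _] := hx s (leq_trans (lek s) ka).
  have [_ _ yB _] := hy (k - s)%N (leq_trans (leq_subr s k) kb).
  exact: (tensmxS xA yB).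
- by apply: stable_tensmx; [have [] := sl2_iso_irr_stable hA | have [] := sl2_iso_irr_stable hB].
Qed.

Lemma sum_clebsch_gordan a b :
  (\sum_(c <- [seq (a + b - 2 * k)%N | k <- iota 0 (minn a b).+1]) c.+1 = a.+1 * b.+1)%N.
Proof.
rewrite big_map (_ : iota 0 _ = index_iota 0 (minn a b).+1); last by rewrite /index_iota subn0.
rewrite big_mkord.
(* The quadratic term stays on the left so that no truncated subtraction appears outside the
   summands. *)
have e j : (j <= (minn a b).+1)%N ->
    (\sum_(k < j) (a + b - 2 * k).+1 + j * j = j * (a + b + 2))%N.
  elim: j => [|j IHj] hj; first by rewrite big_ord0.
  have := IHj (ltnW hj); rewrite big_ord_recr /= !mulSn mulnS.
  by have hj' : (2 * j <= a + b)%N; lia.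
have := e _ (leqnn _); case: (leqP a b) => h; rewrite ?(minn_idPl h) ?(minn_idPr (ltnW h)); nia.
Qed.

Lemma uniq_clebsch_gordan a b : uniq [seq (a + b - 2 * k)%N | k <- iota 0 (minn a b).+1].
Proof.
rewrite map_inj_in_uniq ?iota_uniq // => i j; rewrite !mem_iota; lia.
Qed.

End ClebschGordan.

(** * Invariants and simple submodules *)

Section Simple.
Variable F : fieldType.
Hypothesis hchar : [pchar F] =i pred0.
Variables (m n : nat) (M : gact F m n).
Hypothesis hM : is_gmod M.

(** Because r is an ideal: [swap] says that if X and the commutator of X with A both kill the
    invariants, then so does [A *m X]. *)
Lemma rinv_gsub : gsub M (rinv M 1%:M).
Proof.
have /(rinvP hchar hM)[_ hz] := submx_refl (rinv M 1%:M).
have h0 := zop_ker hchar hM hz; have [_ _ _ _ hX] := hM.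
have kill (A : 'M_n) : (forall k, (k <= m)%N -> rinv M 1%:M *m (A *m gX M k) = 0) ->
    stablemx (rinv M 1%:M) A.
  move=> h; apply/(rinvP hchar hM); split; first exact: submx1.
  by move=> k hk; rewrite /zop -scalemxAr -mulmxA h ?scaler0 // leq_subr.
have swap (A X Y : 'M[F]_n) : lie X A = Y -> rinv M 1%:M *m X = 0 ->
    rinv M 1%:M *m Y = 0 -> rinv M 1%:M *m (A *m X) = 0.
  move=> <- hx; rewrite /lie mulmxBr (mulmxA _ X A) hx mul0mx sub0r => /eqP.
  by rewrite oppr_eq0 => /eqP.
split.
- by apply: kill => k hk; have [_ e _ _] := hX 0%N k hk; apply: (swap _ _ _ e); rewrite -?scalemxAr h0 ?scaler0.
- by apply: kill => k hk; have [_ _ e _] := hX 0%N k hk; apply: (swap _ _ _ e); rewrite h0.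
- by apply: kill => k hk; have [e _ _ _] := hX 0%N k hk; apply: (swap _ _ _ e); rewrite -?scalemxAr h0 ?scaler0.
- by move=> j; rewrite h0 sub0mx.
Qed.

Lemma gsub_cap U U' : gsub M U -> gsub M U' -> gsub M (U :&: U')%MS.
Proof.
case=> [e f h x] [e' f' h' x'].
have st A : stablemx U A -> stablemx U' A -> stablemx (U :&: U')%MS A.
  move=> s s'; rewrite sub_capmx.
  by rewrite (submx_trans (submxMr A (capmxSl _ _))) ?(submx_trans (submxMr A (capmxSr _ _))).
by split; [apply: st | apply: st | apply: st | move=> j; apply: st].
Qed.

(** Where r acts by zero, a g_m-submodule is the same as an sl(2)-submodule, and [irr_sub] applies.
    S is the bottom term of the socle series, given only up to equality of row spaces. *)
Lemma simple_irr (S U : 'M_n) c : (S == (0 : 'M_n))%MS -> sl2_iso_irr M U c ->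
  (forall j, U *m gX M j = 0) -> simple_over M S U.
Proof.
move=> /eqmxP S0 hU UX; have [UE UF UH] := sl2_iso_irr_stable hU.
have S0' : S = 0 by apply/eqP; rewrite -submx0 S0 submx_refl.
rewrite S0'; split.
- by split; rewrite ?mul0mx ?sub0mx // => j; rewrite mul0mx sub0mx.
- by split=> // j; rewrite UX sub0mx.
- by rewrite /ltmx sub0mx submx0 -mxrank_eq0 (sl2_iso_irr_rank hU).
move=> Y [YE YF _ _] _ YU; have [Y0|Yn0] := eqVneq Y 0.
  by left; rewrite Y0; apply/eqmxP.
right; rewrite YU /=; have [B [_ /eqmxP BU hE hF _]] := hU.
have /rowV0Pn[z zY z0] := Yn0.
have /submxP[x ex] : (z <= B)%MS by rewrite BU (submx_trans zY).
rewrite -BU; apply: (irr_sub hchar hE hF YE YF (x := x)); last by rewrite -ex.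
by apply: contraNneq z0 => x0; rewrite ex x0 mul0mx.
Qed.

End Simple.

(** * The socle of a tensor product *)

Section SocleOfTensor.
Variables (F : fieldType) (m n p : nat) (V : gact F m n) (W : gact F m p).
Hypotheses (hchar : [pchar F] =i pred0) (hm : (1 <= m)%N).
Hypotheses (hV : is_gmod V) (hW : is_gmod W).
Variables (d d' : bool) (l l' : nat) (a b : nat -> nat).
Variables (Vc : nat -> 'M[F]_n) (w : nat -> nat -> 'rV[F]_n) (ws : nat -> nat -> 'cV[F]_n).
Variables (Wc : nat -> 'M[F]_p) (v : nat -> nat -> 'rV[F]_p) (vs : nat -> nat -> 'cV[F]_p).
Hypotheses (gV : graded_basis V d l a Vc w ws) (gW : graded_basis W d' l' b Wc v vs).

Local Notation T := (gtens V W).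
Local Notation L := (minn l l').
Local Notation S := (S_t V W l l' Vc Wc).
Local Notation Inv := (rinv T 1%:M).
Local Notation crd := (coord ws vs).

Let hT : is_gmod T := gmod_tens hV hW.
Let coord0 i s j r : crd 0 i s j r = 0.
Proof. by rewrite /coord /tens_eval mul0mx mxE. Qed.
Let admP t u := S_t_admissible hchar hV hW gV gW t u.
Let ext := coord_ext gV gW.
Let outl u i s j r : ~~ in_range l a i s -> crd u i s j r = 0.
Proof. by move=> h; rewrite /coord (gb_out gV h) tens_eval0l. Qed.
Let outr u i s j r : ~~ in_range l' b j r -> crd u i s j r = 0.
Proof. by move=> h; rewrite /coord (gb_out gW h) tens_eval0r. Qed.

Lemma degree_dichotomy t : (1 <= t <= L)%N ->
  (exists c, irr_degree F m d d' l l' a b t c) \/ zero_degree F m d d' l l' a b t.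
Proof.
case/andP=> t1 tL; have := gb_chain gV; have := gb_chain gW.
case: (d); case: (d') => cb ca.
- by right; apply: zero_degree_dual.
- have t1' : (t <= minn l' l)%N by rewrite minnC.
  have [h|h] := leqP (b 0%N) (a t).
    by left; exists (a t - b 0)%N; apply: irr_degree_swap; apply: irr_degree_mixed.
  by right; apply: zero_degree_swap; apply: zero_degree_mixed.
- have [h|h] := leqP (a 0%N) (b t).
    by left; exists (b t - a 0)%N; apply: irr_degree_mixed.
  by right; apply: zero_degree_mixed.
- by left; exists (a 0 + b 0 + m * t)%N; apply: irr_degree_hankel.
Qed.

Lemma S_t_gtn_eq0 t : (L < t)%N -> S t = 0.
Proof.
move=> h; apply/eqP; rewrite -submx0.
by have /andP[] := S_t_zero hchar hV hW gV gW (zero_degree_gt (F := F) (gb_chain gV) (gb_chain gW) h).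
Qed.

Lemma S_t_sub_inv t : (S t <= Inv)%MS.
Proof.
have /(rinvP hchar hT)[_ hz] := submx_refl (S t).
by apply/(rinvP hchar hT); split; rewrite ?submx1.
Qed.

(** Every z_k lowers the degree by exactly one, so the homogeneous components of an invariant are
    invariant. They run up to degree l + l', but vanish above min(l, l'). *)
Lemma inv_sum : (Inv == \sum_(t < L.+1) S t)%MS.
Proof.
apply/andP; split; last by apply/sumsmx_subP => t _; apply: S_t_sub_inv.
apply/row_subP => q; set u := row q _.
have /(rinvP hchar hT)[_ uz] : (u <= Inv)%MS by apply: row_sub.
pose y t i s j r := if (i + j == t)%N then crd u i s j r else 0.
have uE : u = \sum_(t < (l + l').+1) of_coord l l' a b w v (y t).
  apply: ext => i s j r hs hr; rewrite coord_sum.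
  have lt_ij : (i + j < (l + l').+1)%N.
    by move: hs hr; rewrite /in_range; lia.
  rewrite (bigD1 (Ordinal lt_ij)) //= big1 ?addr0 => [|t ne].
    by rewrite (coord_of_coord gV gW) // /y eqxx.
  by rewrite (coord_of_coord gV gW) // /y ifF //; apply/negbTE; rewrite eq_sym.
have vS t : (of_coord l l' a b w v (y t) <= S t)%MS.
  have e i s j r : crd (of_coord l l' a b w v (y t)) i s j r = y t i s j r.
    have [h|h] := boolP (in_range l a i s); last first.
      by rewrite /y !outl // if_same.
    have [h'|h'] := boolP (in_range l' b j r); last first.
      by rewrite /y !outr // if_same.
    by rewrite (coord_of_coord gV gW).
  apply/admP; split=> i s j r.
  + by move=> h; rewrite outl.
  + by move=> h; rewrite outr.
  + by move=> /negPf h; rewrite e /y h.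
  move=> k h h' hk; have := coord_zop gV gW u hk h h'; rewrite uz // coord0.
  rewrite /zact !e /y !addSn !addnS; case: ((i + j).+1 == t)%N => // _.
  by rewrite !if_same addr0; case: (d) => //; rewrite ?addr0.
rewrite uE; apply: summx_sub => t _; apply: submx_trans (vS t) _.
have [lt_t|le_t] := ltnP t L.+1; first exact: (sumsmx_sup (Ordinal lt_t)).
by rewrite S_t_gtn_eq0 // sub0mx.
Qed.

(** There is no degree below 0, so r kills the whole degree 0 part. *)
Lemma S_t_0 : (S 0 == Vc 0%N *t Wc 0%N)%MS.
Proof.
have d0 : (degree_part l l' Vc Wc 0 == Vc 0%N *t Wc 0%N)%MS.
  apply/andP; split.
    apply/sumsmx_subP => i _; apply/sumsmx_subP => j.
    by rewrite addn_eq0 => /andP[/eqP -> /eqP ->].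
  by rewrite (sumsmx_sup ord0) // (sumsmx_sup ord0).
apply/andP; split.
  have /(rinvP hchar hT)[h _] := submx_refl (S 0).
  by rewrite -(eqmxP d0).
apply/row_subP => q; set u := row q _.
have /(degree_partP gV gW) ud : (u <= degree_part l l' Vc Wc 0)%MS.
  by rewrite (eqmxP d0) row_sub.
have u0 i s j r : (i + j != 0)%N -> crd u i s j r = 0.
  have [h|h] := boolP (in_range l a i s); last by rewrite outl.
  by have [h'|h'] := boolP (in_range l' b j r); [apply: ud | rewrite outr].
apply/admP; split=> // i s j r.
+ by move=> h; rewrite outl.
+ by move=> h; rewrite outr.
+ move=> k h h' hk; rewrite /zact.
  by case: (d); case: (d'); do ?case: ifP => _; rewrite ?u0 ?addr0 // addnS.
Qed.

Lemma S_t_direct : \rank (\sum_(t < L.+1) S t)%MS = (\sum_(t < L.+1) \rank (S t))%N.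
Proof.
have /mxdirectP/= -> // : mxdirect (\sum_(t < L.+1) S t).
apply/mxdirect_sumsP => t _; apply/eqP/rowV0P => u; rewrite sub_capmx => /andP[].
case/admP=> _ _ dg _ /sub_sumsmxP[z uE].
apply: ext => i s j r hs hr; rewrite coord0.
have [e|/dg//] := eqVneq (i + j)%N t.
rewrite uE coord_sum big1 // => t' /andP[_ ne].
have /admP[_ _ dg' _] := submxMl (z t') (S t').
by apply: dg'; rewrite e eq_sym.
Qed.

(* Acting by [r] lowers the degree, so the kernel is reached in finitely many steps. *)
Lemma gsub_inv_eq0 U : gsub T U -> (U :&: Inv)%MS = 0 -> U = 0.
Proof.
case=> _ _ _ UX UI.
suff key N (u : 'rV_(n * p)) : (u <= U)%MS ->
  (forall i s j r, (N <= i + j)%N -> crd u i s j r = 0) -> u = 0.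
  apply/eqP/rowV0P => u uU; apply: (key (l + l').+1) => // i s j r h.
  have [hi|hi] := leqP i l; last by rewrite outl // /in_range; lia.
  by rewrite outr // /in_range; lia.
elim: N u => [|N IHN] u uU hu; first by apply: ext => *; rewrite coord0 hu.
apply/eqP; rewrite -submx0 -UI sub_capmx uU; apply/(rinvP hchar hT).
split; [exact: submx1 | move=> k hk]; apply: IHN.
  rewrite /zop -scalemxAr scalemx_sub //.
  exact: submx_trans (submxMr _ uU) (UX _).
move=> i s j r hij.
have [h|h] := boolP (in_range l a i s); last by rewrite outl.
have [h'|h'] := boolP (in_range l' b j r); last by rewrite outr.
rewrite (coord_zop gV gW) // /zact.
by case: (d); case: (d'); do ?case: ifP => _; rewrite ?hu ?addr0 //; lia.
Qed.

Lemma S_t_0_sum : sl2_iso_sum T (S 0)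
  [seq (a 0%N + b 0%N - 2 * k)%N | k <- iota 0 (minn (a 0%N) (b 0%N)).+1].
Proof.
have hA := gb_irr gV (leq0n l); have hB := gb_irr gW (leq0n l').
apply: (sl2_iso_sum_uniq hchar); first exact: uniq_clebsch_gordan.
  move=> c /mapP[k]; rewrite mem_iota add0n ltnS /= => hk ->.
  have [U hU US] := clebsch_gordan hchar hV hW hA hB hk.
  by exists U; rewrite ?(eqmxP S_t_0).
rewrite sum_clebsch_gordan (eqmxP S_t_0) mxrank_tensmx.
by rewrite (sl2_iso_irr_rank hA) (sl2_iso_irr_rank hB).
Qed.

(** A simple submodule meets the submodule [Inv], hence lies in it. Conversely each S_t is zero or
    irreducible for t >= 1 and a sum of irreducibles for t = 0; as r kills them, these irreducibles
    are simple over g_m. *)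
Lemma soc_tens socT : is_soc T socT -> (socT == Inv)%MS.
Proof.
case=> Z [/= Z0 [_ _ hsimple [k [Us [hUs sT]]]]].
have Zz : Z = 0 by apply/eqP; rewrite -submx0; case/andP: Z0.
apply/andP; split.
  rewrite (eqmxP sT) Zz addsmx_sub sub0mx; apply/sumsmx_subP => i _.
  have [_ gU + max] := hUs i; rewrite Zz /ltmx => /andP[_ Un0].
  case: (max (Us i :&: Inv)%MS) => [||| e | /andP[_ e]].
  - by apply: gsub_cap => //; apply: rinv_gsub.
  - by rewrite Zz sub0mx.
  - exact: capmxSl.
  - case/negP: Un0; rewrite submx0; apply/eqP/gsub_inv_eq0 => //.
    by apply/eqP; rewrite -submx0 -Zz; case/andP: e.
  - exact: submx_trans e (capmxSr _ _).
have killed (U : 'M_(n * p)) : (U <= Inv)%MS -> forall j, U *m gX T j = 0.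
  by case/(rinvP hchar hT) => _ hz; apply: (zop_ker hchar hT).
have irr_le c U : sl2_iso_irr T U c -> (U <= Inv)%MS -> (U <= socT)%MS.
  by move=> hU hI; apply: hsimple; apply: simple_irr hU _ => //; apply: killed.
rewrite (eqmxP inv_sum); apply/sumsmx_subP => -[[|t] ht] _ /=.
  have [Us' [h1 h2 _]] := S_t_0_sum; rewrite -(eqmxP h2).
  apply/sumsmx_subP => i _; apply: irr_le (h1 i) _.
  apply: submx_trans (S_t_sub_inv 0); rewrite -(eqmxP h2).
  exact: (sumsmx_sup i).
case: (@degree_dichotomy t.+1) => // [[c hc]|hz].
  exact: irr_le (S_t_irr hchar hV hW gV gW hc) (S_t_sub_inv _).
by have /andP[/submx_trans -> //] := S_t_zero hchar hV hW gV gW hz; apply: sub0mx.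
Qed.

Lemma soc_tens_sum socT : is_soc T socT ->
  (socT == \sum_(t < L.+1) S t)%MS /\ \rank socT = (\sum_(t < L.+1) \rank (S t))%N.
Proof.
move=> /soc_tens e; rewrite -S_t_direct; split; last by rewrite (eqmxP e) (eqmxP inv_sum).
by apply/eqmxP; apply: eqmx_trans (eqmxP e) (eqmxP inv_sum).
Qed.

Lemma soc_tens_iso_sum (P : pred nat) (D : nat -> nat) (s : seq nat) socT :
  (forall t, (1 <= t <= L)%N -> P t -> sl2_iso_irr T (S t) (D t)) ->
  (forall t, (1 <= t <= L)%N -> ~~ P t -> S t = 0) ->
  uniq s ->
  perm_eq s ([seq (a 0%N + b 0%N - 2 * k)%N | k <- iota 0 (minn (a 0%N) (b 0%N)).+1]
             ++ [seq D t | t <- iota 1 L & P t]) ->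
  is_soc T socT -> sl2_iso_sum T socT s.
Proof.
move=> hP hN us es /soc_tens_sum[eT rT].
have [Us [h1 h2 h3]] := S_t_0_sum.
apply: (sl2_iso_sum_uniq hchar) => //.
  move=> c; rewrite (perm_mem es) mem_cat => /orP[hc|/mapP[t]].
    have lt_c : (index c [seq (a 0 + b 0 - 2 * k) | k <- iota 0 (minn (a 0) (b 0)).+1]%N
                  < size [seq (a 0 + b 0 - 2 * k) | k <- iota 0 (minn (a 0) (b 0)).+1]%N)%N.
      by rewrite index_mem.
    exists (Us (Ordinal lt_c)); first by have := h1 (Ordinal lt_c); rewrite nth_index.
    rewrite (eqmxP eT) (sumsmx_sup ord0) // -(eqmxP h2); exact: (sumsmx_sup (Ordinal lt_c)).
  rewrite mem_filter mem_iota => /andP[Pt ht] ->; exists (S t).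
    by apply: hP => //; lia.
  have lt_t : (t < L.+1)%N by lia.
  by rewrite (eqmxP eT) (sumsmx_sup (Ordinal lt_t)).
rewrite rT (perm_big _ es) big_cat /= sum_clebsch_gordan big_ord_recl.
have hA := gb_irr gV (leq0n l); have hB := gb_irr gW (leq0n l').
rewrite (eqmxP S_t_0) mxrank_tensmx (sl2_iso_irr_rank hA) (sl2_iso_irr_rank hB) leq_add2l.
rewrite big_map big_filter -[X in (X <= _)%N](big_mkord predT (fun t => \rank (S t.+1))).
have -> : iota 1 L = [seq t.+1 | t <- index_iota 0 L].
  by rewrite /index_iota subn0 -[1%N]addn0 iotaDl; apply: eq_map => t; rewrite add1n.
rewrite big_map big_mkord [X in (_ <= X)%N]big_mkcond /= big_mkord leq_sum // => t _.
have ht : (1 <= t.+1 <= L)%N by have := ltn_ord t; lia.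
case: ifP => [/(hP _ ht)/sl2_iso_irr_rank -> // | /negbT/(hN _ ht) ->].
by rewrite mxrank0.
Qed.

End SocleOfTensor.

(** * Monomial bases of type Z modules *)

Section Construction.
Variable F : fieldType.
Hypothesis hchar : [pchar F] =i pred0.

Lemma dual_basis n (I : finType) (e : I -> 'rV[F]_n) : #|I| = n ->
  (1%:M <= \sum_x <<e x>>)%MS ->
  exists es : I -> 'cV[F]_n, (forall x y, (e x *m es y) 0 0 = (x == y)%:R) /\
    \sum_x es x *m e x = 1%:M.
Proof.
move=> cI full; pose A := \matrix_(k < #|I|) e (enum_val k).
have fA : row_full A.
  rewrite -sub1mx (submx_trans full) //; apply/sumsmx_subP => x _.
  by rewrite genmxE -(enum_rankK x) -[e _](rowK (fun k => e (enum_val k))) row_sub.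
have rA : row_free A by rewrite /row_free (eqP fA) cI.
exists (fun x => col (enum_rank x) (pinvmx A)); split=> [x y|].
  have := congr1 (fun M : 'M_#|I| => M (enum_rank x) (enum_rank y)) (mulmxVp rA).
  rewrite !mxE (inj_eq enum_rank_inj) => <-.
  by apply: eq_bigr => k _; rewrite !mxE enum_rankK.
rewrite -(mulVpmx fA); apply/matrixP => i j; rewrite summxE mxE.
rewrite (reindex_onto (@enum_val I I) enum_rank) /=; last by move=> x _; rewrite enum_rankK.
rewrite (eq_bigl xpredT) => [|k]; last by rewrite enum_valK eqxx.
apply: eq_bigr => k _; rewrite mxE big_ord_recl big_ord0 addr0 !mxE enum_valK.
by [].
Qed.

Lemma graded_dual_basis n l (a : nat -> nat) (w : nat -> nat -> 'rV[F]_n) :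
  (\sum_(i < l.+1) (a i).+1 = n)%N ->
  (1%:M <= \sum_(i < l.+1) \sum_(s < (a i).+1) <<w i s>>)%MS ->
  (forall i s, ~~ in_range l a i s -> w i s = 0) ->
  exists ws : nat -> nat -> 'cV[F]_n,
    [/\ forall i s, ~~ in_range l a i s -> ws i s = 0,
        forall i s i' s', (w i s *m ws i' s') 0 0 =
          [&& in_range l a i s, i == i' & s == s']%:R &
        \sum_(i < l.+1) \sum_(s < (a i).+1) ws i s *m w i s = 1%:M].
Proof.
move=> dimn full wout; pose I : finType := {i : 'I_l.+1 & 'I_(a i).+1}.
pose e (x : I) := w (tag x) (tagged x).
have cI : #|I| = n.
  by rewrite card_tagged sumnE big_map big_enum -dimn; apply: eq_bigr => i _; rewrite card_ord.
have [|es [esd es1]] := dual_basis (e := e) cI.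
  apply: submx_trans full _; apply/sumsmx_subP => i _; apply/sumsmx_subP => s _.
  exact: (sumsmx_sup (Tagged (fun i : 'I_l.+1 => 'I_(a i).+1) s)).
pose ws i s : 'cV_n := if insub i : option 'I_l.+1 is Some i' then
  (if insub s : option 'I_(a i').+1 is Some s' then
     es (Tagged (fun i : 'I_l.+1 => 'I_(a i).+1) s') else 0) else 0.
have wsE (i : 'I_l.+1) (s : 'I_(a i).+1) :
    ws i s = es (Tagged (fun i : 'I_l.+1 => 'I_(a i).+1) s).
  by rewrite /ws !valK.
have wsout i s : ~~ in_range l a i s -> ws i s = 0.
  rewrite /in_range /ws; case: insubP => // i' _ <-; rewrite leq_ord /=.
  by case: insubP => // s' _ <-; rewrite leq_ord.
exists ws; split=> // [i s i' s'|]; last first.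
  rewrite -es1 sig_big_dep /=; apply: eq_bigr => -[i s] _ /=.
  by rewrite wsE.
have [h|h] /= := boolP (in_range l a i s); last by rewrite wout // mul0mx mxE.
have [h'|h'] := boolP (in_range l a i' s'); last first.
  rewrite wsout // mulmx0 mxE; case: eqP => // ei; case: eqP => // es'.
  by move: h h'; rewrite ei es' => ->.
case/andP: h h' => hi hs /andP[hi' hs'].
have := esd (Tagged (fun i : 'I_l.+1 => 'I_(a i).+1) (Ordinal (hs : s < (a (Ordinal (hi : i < l.+1))).+1)))%N
  (Tagged (fun i : 'I_l.+1 => 'I_(a i).+1) (Ordinal (hs' : s' < (a (Ordinal (hi' : i' < l.+1))).+1)))%N.
rewrite -wsE /e /= => ->; congr (_%:R); congr nat_of_bool.
apply/eqP/andP => [ex|[/eqP ei /eqP es']].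
  by split; apply/eqP; [have := congr1 (fun x : I => val (tag x)) ex
     | have := congr1 (fun x : I => val (tagged x)) ex].
by subst i' s'; rewrite (bool_irrelevance hi' hi) (bool_irrelevance hs' hs).
Qed.

(** Divided powers are used because r then acts with coefficients independent of s. The last clause
    says that weight spaces are at most lines; r may exceed c, and then [x r = 0] forces y = 0. *)
Definition weight_rows m n (M : gact F m n) (U : 'M_n) c (x : nat -> 'rV[F]_n) : Prop :=
  [/\ forall s, (c < s)%N -> x s = 0,
      forall s, x s *m gF M = s.+1%:R *: x s.+1,
      forall s, (s <= c)%N -> x s *m gE M =
         if s is s'.+1 then (c - s')%:R *: x s' else 0,
      forall s, x s *m gH M = (c%:R - (2 * s)%:R) *: x s /\ (x s <= U)%MS &
      [/\ (U == \sum_(s < c.+1) <<x s>>)%MS &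
      forall (y : 'rV_n) mu r, (y <= U)%MS -> y *m gH M = mu *: y ->
        (forall s, (s <= c)%N -> s != r -> mu != c%:R - (2 * s)%:R) ->
        exists th, y = th *: x r]].

(* The rows are the images of [v_s / s!]. *)
Lemma irr_rows m n (M : gact F m n) (U : 'M_n) c : sl2_iso_irr M U c ->
  exists x, weight_rows M U c x.
Proof.
case=> B [fB /eqmxP BU hE hF hH].
pose g s : F := (s`!%:R)^-1.
have g0 s : (s`!%:R : F) != 0 by rewrite natr_eq0 // eqn0Ngt fact_gt0.
pose x s := if (s <= c)%N then g s *: row (inord s) B else 0.
have rowd i : row i B = delta_mx 0 i *m B by rewrite rowE.
have xE s : (s <= c)%N -> x s = g s *: row (inord s) B by rewrite /x => ->.
have x0 s : (c < s)%N -> x s = 0 by move=> h; rewrite /x leqNgt h.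
exists x; split=> //.
- move=> s; have [le_s|lt_s] := leqP s c; last by rewrite !x0 ?mul0mx ?scaler0 // ltnW.
  rewrite xE // rowd -scalemxAl -mulmxA -hF mulmxA.
  move: le_s; rewrite leq_eqVlt => /orP[/eqP es|lt_s].
    rewrite x0 ?es // scaler0 (_ : _ *m stdF F c = 0) ?mul0mx ?scaler0 //.
    rewrite -rowE; apply/rowP => j; rewrite !mxE inordK //.
    by rewrite ltn_eqF // (leq_trans (ltn_ord j)).
  rewrite delta_stdF inordK // ?ltnS ?(ltnW lt_s) // -rowd xE // scalerA; congr (_ *: _).
  by rewrite /g factS natrM invfM mulrA divff ?mul1r // natr_eq0.
- move=> [|s] hs; rewrite xE // rowd -scalemxAl -mulmxA -hE mulmxA delta_stdE inordK //.
    by rewrite mul0n scale0r mul0mx scaler0.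
  rewrite -scalemxAl -rowd /= xE ?(ltnW hs) // !scalerA; congr (_ *: _).
  rewrite /g factS natrM invfM addn1 subnSK // natrM.
  by rewrite mulrACA mulVf ?mul1r ?natr_eq0 // mulrC.
- move=> s; have [le_s|lt_s] := leqP s c; last by rewrite !x0 // mul0mx scaler0 sub0mx.
  rewrite xE // rowd -scalemxAl; split; last first.
    by rewrite scalemx_sub // -BU submxMl.
  rewrite -mulmxA -hH mulmxA delta_stdH inordK // -!scalemxAl !scalerA; congr (_ *: _).
  exact: mulrC.
split.
  apply/andP; split; last first.
    apply/sumsmx_subP => s _; rewrite genmxE xE ?leq_ord // scalemx_sub // -BU row_sub //.
  rewrite -BU; apply/row_subP => s; rewrite (sumsmx_sup s) // genmxE.
  rewrite xE ?leq_ord // inord_val (eqmx_scale _ _) ?invr_eq0 //.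
move=> y mu r yU yH hmu; have /submxP[z ez] : (y <= B)%MS by rewrite BU.
have zH : z *m stdH F c = mu *: z.
  apply: (row_free_inj fB); rewrite -mulmxA hH mulmxA -ez yH -scalemxAl -ez //.
have zs (s : 'I_c.+1) : s != r :> nat -> z 0 s = 0.
  move=> ne; have := congr1 (fun A : 'rV_c.+1 => A 0 s) zH; rewrite !mxE (bigD1 s) //= big1.
    rewrite mxE eqxx addr0 [RHS]mulrC => /eqP; rewrite -subr_eq0 -mulrBr mulf_eq0 subr_eq0.
    by rewrite [_ == mu]eq_sym (negPf (hmu s (leq_ord s) ne)) orbF => /eqP.
  by move=> j /negPf nj; rewrite mxE nj mulr0.
have [le_r|lt_r] := leqP r c.
  exists (z 0 (inord r) * r`!%:R); rewrite xE // scalerA mulfK // ez mulmx_sum_row.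
  rewrite (bigD1 (inord r)) //= big1 ?addr0 // => j.
  by rewrite -val_eqE /= inordK // => /zs ->; rewrite scale0r.
exists 0; rewrite scale0r ez (_ : z = 0) ?mul0mx //; apply/rowP => j; rewrite mxE zs //.
by rewrite ltn_eqF // (leq_trans (ltn_ord j)).
Qed.

Lemma zop_gF m n (M : gact F m n) k : is_gmod M -> (k <= m)%N ->
  zop M k *m gF M = gF M *m zop M k - k%:R *: zop M k.-1.
Proof.
case=> _ _ _ X0 hX hk; have [_ _ e _] := hX 0%N (m - k)%N (leq_subr _ _).
rewrite /zop -scalemxAl -scalemxAr.
have -> : gX M (m - k) *m gF M = gX M (m - k).+1 + gF M *m gX M (m - k).
  by rewrite -e /lie subrK.
rewrite scalerDr addrC; congr (_ + _).
case: k hk {e} => [|k] hk /=; first by rewrite subn0 X0 // scaler0 scale0r oppr0.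
rewrite subnSK // scalerA -scaleNr; congr (_ *: _).
rewrite factS natrM (_ : (m - k)%N = (m - k.+1).+1); last by lia.
by rewrite exprS; ring.
Qed.

(* Uniqueness of the equivariant map V(m) (x) V(a+m) -> V(a): commutation with
   [f] alone determines it from [x_m v_0]. *)
Lemma lowering m n (M : gact F m n) a (U U' : 'M_n) (x x' : nat -> 'rV[F]_n) :
  is_gmod M ->
  (forall s, (a < s)%N -> x' s = 0) ->
  (forall s, x s *m gF M = s.+1%:R *: x s.+1) ->
  (forall s, x' s *m gF M = s.+1%:R *: x' s.+1) ->
  (forall s, x s *m gH M = ((a + m)%:R - (2 * s)%:R) *: x s /\ (x s <= U)%MS) ->
  (forall (y : 'rV_n) mu r, (y <= U')%MS -> y *m gH M = mu *: y ->
        (forall s, (s <= a)%N -> s != r -> mu != a%:R - (2 * s)%:R) ->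
        exists th, y = th *: x' r) ->
  (forall j, (U *m gX M j <= U')%MS) ->
  exists c, forall k s, (k <= m)%N ->
    x s *m zop M k = if (k <= s)%N then c *: x' (s - k)%N else 0.
Proof.
move=> hM x'0 xF x'F xH wt UX; pose y k s := x s *m zop M k.
have yU k s : (y k s <= U')%MS.
  rewrite /y /zop -scalemxAr scalemx_sub //.
  exact: submx_trans (submxMr _ (xH s).2) (UX _).
have yH k s : (k <= m)%N -> y k s *m gH M = (a%:R - (2 * s)%:R + (2 * k)%:R) *: y k s.
  move=> hk; have [_ _ _ _ hX] := hM; have [e _ _ _] := hX 0%N (m - k)%N (leq_subr _ _).
  have eZ : zop M k *m gH M = gH M *m zop M k + ((2 * k)%:R - m%:R) *: zop M k.
    have eX : gX M (m - k) *m gH M =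
        gH M *m gX M (m - k) + ((2 * k)%:R - m%:R) *: gX M (m - k).
      rewrite -[LHS](subrK (gH M *m gX M (m - k))) -/(lie _ _) e addrC.
      by congr (_ + _ *: _); rewrite mulnBr natrB ?leq_mul2l ?hk ?orbT // !natrM; ring.
    by rewrite /zop -scalemxAl -scalemxAr eX scalerDr !scalerA [X in _ + X *: _]mulrC.
  rewrite /y -mulmxA eZ mulmxDr mulmxA (xH s).1 -scalemxAl -(scalemxAr _ _ (zop M k)) -scalerDl.
  by congr (_ *: _); rewrite natrD; ring.
have yF k s : (k <= m)%N -> y k s *m gF M = s.+1%:R *: y k s.+1 - k%:R *: y k.-1 s.
  move=> hk; rewrite /y -mulmxA zop_gF // mulmxBr mulmxA xF -scalemxAl -(scalemxAr _ _ (zop M k.-1)) //.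
(* The weight a + 2(k - s) exceeds a, so it does not occur in U'; the index a + 1 selects the zero
   row. *)
have ylow k s : (k <= m)%N -> (s < k)%N -> y k s = 0.
  move=> hk lt_sk; have [|th ->] := wt _ _ a.+1 (yU k s) (yH k s hk); last by rewrite x'0 ?scaler0.
  move=> s' _ _; apply/eqP => e; have : ((2 * k + 2 * s')%:R : F) = (2 * s)%:R.
    rewrite !natrD; apply/eqP; rewrite -subr_eq0; apply/eqP.
    have := congr1 (fun z => z - a%:R + (2 * s)%:R + (2 * s')%:R - (2 * s)%:R) e => h.
    transitivity (a%:R - (2 * s)%:R + (2 * k)%:R - a%:R + (2 * s)%:R + (2 * s')%:R - (2 * s)%:R : F); first by ring.
    by rewrite h; ring.
  by move/(natr_inj hchar); lia.
have [|c hc] := wt _ _ 0%N (yU 0%N 0%N) (yH 0%N 0%N (leq0n m)).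
  move=> s hs ne; rewrite !muln0 subr0 addr0; apply/eqP => /eqP.
  rewrite eq_sym -subr_eq0 addrC addKr oppr_eq0 natr_eq0 //; lia.
exists c => k s hk; rewrite -/(y k s); case: leqP => [|/ylow -> //].
(* For k = 0, f propagates the value from s = 0. For k + 1, f applied to y (k+1) k = 0 gives the
   value at s = k + 1, and [yF] then continues in s. *)
elim: k s hk => [|k IHk] s hk.
  rewrite subn0 => _; elim: s => // s IHs.
  have := yF 0%N s hk; rewrite scale0r subr0 IHs -scalemxAl x'F scalerA mulrC -scalerA.
  by move/(scalerI _) => <- //; rewrite natr_eq0.
elim: s => // s IHs; rewrite ltnS => le_ks; rewrite subSS.
have k1 : (k.+1%:R : F) != 0 by rewrite natr_eq0.
have s1 : (s.+1%:R : F) != 0 by rewrite natr_eq0.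
have := yF k.+1 s hk; rewrite /= (IHk s (ltnW hk) le_ks).
move: le_ks; rewrite leq_eqVlt => /orP[/eqP es|lt_ks].
  rewrite (ylow _ _ hk) -?es // mul0mx => /esym/eqP; rewrite subr_eq0 => /eqP.
  by move/(scalerI k1).
rewrite (IHs lt_ks) -scalemxAl x'F (subnSK lt_ks) => h; apply: (scalerI s1).
move/eqP: h; rewrite eq_sym subr_eq => /eqP ->.
rewrite !scalerA -scalerDl; congr (_ *: _).
by rewrite natrB ?(ltnW lt_ks) // -!natr1; ring.
Qed.

End Construction.

(** * Normalised bases of Z and of its dual *)

Section FromIsZ.
Variable F : fieldType.
Hypothesis hchar : [pchar F] =i pred0.

(** The action on the basis itself rather than on its dual. Passing to the dual basis gives the
    graded basis of Z, and transposing that one gives Z^*. *)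
Record zrows m n (M : gact F m n) l (a : nat -> nat) (Wc : nat -> 'M[F]_n)
    (w : nat -> nat -> 'rV[F]_n) (ws : nat -> nat -> 'cV[F]_n) : Prop := ZRows {
  zr_irr : forall i, (i <= l)%N -> sl2_iso_irr M (Wc i) (a i);
  zr_span : forall i, (i <= l)%N -> (Wc i == \sum_(s < (a i).+1) <<w i s>>)%MS;
  zr_out : forall i s, ~~ in_range l a i s -> w i s = 0;
  zr_F : forall i s, w i s *m gF M = s.+1%:R *: w i s.+1;
  zr_E : forall i s, in_range l a i s -> w i s *m gE M =
         if s is s'.+1 then (a i - s')%:R *: w i s' else 0;
  zr_H : forall i s, w i s *m gH M = ((a i)%:R - (2 * s)%:R) *: w i s;
  zr_Z : forall i s k, (i <= l)%N -> (k <= m)%N -> w i s *m zop M k =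
     if i is i'.+1 then (if (k <= s)%N then w i' (s - k)%N else 0) else 0;
  zr_wsout : forall i s, ~~ in_range l a i s -> ws i s = 0;
  zr_dual : forall i s i' s', (w i s *m ws i' s') 0 0 =
          [&& in_range l a i s, i == i' & s == s']%:R;
  zr_id : \sum_(i < l.+1) \sum_(s < (a i).+1) ws i s *m w i s = 1%:M }.

Lemma isZ_zrows m n (M : gact F m n) al l : is_gmod M -> isZ M al l ->
  exists Wc w ws, zrows M l (fun i => al + i * m)%N Wc w ws.
Proof.
move=> hM [Wc [hirr hfull hrank hX0 hX]]; pose a i := (al + i * m)%N.
have /fin_all_exists[x hx] (i : 'I_l.+1) := irr_rows hchar (hirr i (leq_ord i)).
pose X i := x (inord i).
have hXr i : (i <= l)%N -> weight_rows M (Wc i) (a i) (X i).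
  by move=> hi; have := hx (inord i); rewrite /X inordK.
have low (i : 'I_l.+1) : exists c, (0 < i)%N -> c != 0 /\ forall k s, (k <= m)%N ->
    X i s *m zop M k = if (k <= s)%N then c *: X i.-1 (s - k)%N else 0.
  case: i => [[|i] hi]; first by exists 0.
  have [_ xF _ xH [xspan _]] := hXr i.+1 hi.
  have [x'0 x'F _ _ [_ wt]] := hXr i (ltnW hi).
  have [XW [j [hj Xj]]] := hX i.+1 hi.
  have ea : a i.+1 = (a i + m)%N by rewrite /a mulSn; lia.
  rewrite ea in xH; have [c hc] := lowering hchar hM x'0 xF x'F xH wt XW.
  exists c => _; split=> //; apply: contraNneq Xj => c0.
  apply/eqP; apply: (zop_ker hchar hM) => k hk; apply/eqP; rewrite -sub_kermx.
  rewrite (eqmxP xspan); apply/sumsmx_subP => s _; rewrite genmxE sub_kermx.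
  by rewrite hc // c0 scale0r if_same.
have /fin_all_exists[c hc] := low.
pose C i := c (inord i).
have hC i : (i < l)%N -> C i.+1 != 0 /\ forall k s, (k <= m)%N ->
    X i.+1 s *m zop M k = if (k <= s)%N then C i.+1 *: X i (s - k)%N else 0.
  by move=> hi; have := hc (inord i.+1); rewrite /C inordK //; apply.
(* Rescaling the components successively turns all the constants C into 1; this is why the
   isomorphism class of Z does not depend on the chosen scalars. *)
pose ka i := \prod_(j < i) (C j.+1)^-1.
have ka0 i : (i <= l)%N -> ka i != 0.
  move=> hi; apply/prodf_neq0 => j _; rewrite invr_eq0.
  by have [] := hC j (leq_trans (ltn_ord j) hi).
pose w i s := if (i <= l)%N then ka i *: X i s else 0.
have wE i s : (i <= l)%N -> w i s = ka i *: X i s by rewrite /w => ->.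
have w0 i s : (l < i)%N -> w i s = 0 by move=> h; rewrite /w leqNgt h.
have wspan i : (i <= l)%N -> (Wc i == \sum_(s < (a i).+1) <<w i s>>)%MS.
  move=> hi; have [_ _ _ _ [/eqmxP e _]] := hXr i hi.
  apply/eqmxP/(eqmx_trans e)/eqmx_sums => s _; apply/eqmxP; rewrite !genmxE.
  by apply/eqmxP; rewrite wE //; apply/eqmx_sym/eqmx_scale/ka0.
have wout i s : ~~ in_range l a i s -> w i s = 0.
  rewrite /in_range; have [hi|/w0 //] := leqP i l; rewrite -ltnNge => hs.
  by have [x0 _ _ _ _] := hXr i hi; rewrite wE // x0 // scaler0.
have dimn : (\sum_(i < l.+1) (a i).+1 = n)%N.
  rewrite -(mxrank1 F n) hrank; apply: eq_bigr => i _.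
  by rewrite (sl2_iso_irr_rank (hirr i (leq_ord i))).
have full : (1%:M <= \sum_(i < l.+1) \sum_(s < (a i).+1) <<w i s>>)%MS.
  rewrite -(eqmxP hfull); apply: sumsmxS => i _.
  by rewrite (eqmxP (wspan _ (leq_ord i))).
have [ws [wso wsd ws1]] := graded_dual_basis dimn full wout.
exists Wc, w, ws; split=> //.
- move=> i s; have [hi|h] := leqP i l; last by rewrite !w0 // mul0mx scaler0.
  have [_ xF _ _ _] := hXr i hi.
  by rewrite !wE // -scalemxAl xF !scalerA mulrC.
- move=> i s /andP[hi hs]; have [_ _ xE _ _] := hXr i hi.
  rewrite wE // -scalemxAl xE //; case: s {hs} => [|s]; first by rewrite scaler0.
  by rewrite wE // !scalerA mulrC.
- move=> i s; have [hi|h] := leqP i l; last by rewrite !w0 // mul0mx scaler0.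
  have [_ _ _ xH _] := hXr i hi.
  by rewrite !wE // -scalemxAl (xH s).1 !scalerA mulrC.
- move=> [|i] s k hi hk; rewrite wE // -scalemxAl.
    have [_ _ _ xH _] := hXr 0%N hi; have /submxP[z ->] := (xH s).2.
    by rewrite /zop -scalemxAr -mulmxA hX0 mulmx0 !scaler0.
  have [c0 ->] := hC i hi => //; case: ifP => _; last by rewrite scaler0.
  rewrite wE ?(ltnW hi) // scalerA; congr (_ *: _).
  by rewrite /ka big_ord_recr /= mulrVK // unitfE.
Qed.

Lemma scalemx00 (c : F) (A : 'M[F]_1) : (c *: A) 0 0 = c * A 0 0.
Proof. by rewrite mxE. Qed.

Section ZRows.
Variables (m n : nat) (M : gact F m n) (l al : nat) (Wc : nat -> 'M[F]_n).
Variables (w : nat -> nat -> 'rV[F]_n) (ws : nat -> nat -> 'cV[F]_n).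
Local Notation a := (fun i => al + i * m)%N.
Hypothesis zr : zrows M l a Wc w ws.

Lemma zr_ext (c c' : 'cV_n) : (forall i s, in_range l a i s ->
  (w i s *m c) 0 0 = (w i s *m c') 0 0) -> c = c'.
Proof.
move=> h; rewrite -[c]mul1mx -[c']mul1mx -(zr_id zr) !mulmx_suml.
apply: eq_bigr => i _; rewrite !mulmx_suml; apply: eq_bigr => s _.
rewrite -!mulmxA; congr (_ *m _); apply/matrixP => x y; rewrite !ord1 h //.
exact: ord_in_range.
Qed.

(** Functionals see the adjoint action: z_k sends [w i.+1 (s + k)] to [w i s], so it sends [ws i s]
    to [ws i.+1 (s + k)]. *)
Lemma zrows_graded_basis : graded_basis M false l a Wc w ws.
Proof.
split; try by case: zr.
- by move=> i _; rewrite mul0n addn0.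
- by move=> i s i' s' h h'; rewrite (zr_dual zr) h.
- move=> i s hs; apply: zr_ext => i' s' h; rewrite mulmxA (zr_E zr) //.
  rewrite -[in RHS]scalemxAr [in RHS]scalemx00 (zr_dual zr) h /=.
  case: s' h => [|s'] h; first by rewrite mul0mx mxE andbF mulr0.
  rewrite -scalemxAl scalemx00 (zr_dual zr) eqSS (_ : in_range _ _ _ _); last first.
    by move: h; rewrite /in_range; lia.
  by case: eqP => [<-|]; rewrite ?mulr0 //; case: eqP => [<-|]; rewrite ?mulr0.
- move=> i s hs; apply: zr_ext => i' s' h; rewrite mulmxA (zr_F zr) //.
  rewrite -[in RHS]scalemxAr -scalemxAl !scalemx00 !(zr_dual zr) h /=.
  case: s hs => [|s] hs; first by rewrite mul0r !andbF mulr0.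
  rewrite eqSS /=; case: (eqVneq i' i) => [ei|]; rewrite ?andbF ?mulr0 //.
  case: (eqVneq s' s) => [es|]; rewrite ?andbF ?mulr0 //.
  by rewrite (_ : in_range _ _ _ _) ?es // ei.
- move=> i s hs; apply: zr_ext => i' s' h; rewrite mulmxA (zr_H zr) //.
  rewrite -scalemxAr -scalemxAl !scalemx00 !(zr_dual zr) h /hact /=.
  by case: eqP => [->|]; case: eqP => [->|]; rewrite ?mulr0.
- move=> i s k hs hk; apply: zr_ext => i' s' h; rewrite mulmxA.
  have [hi' _] := andP h; rewrite (zr_Z zr) //; rewrite !(zr_dual zr) h /=.
  case: i' {hi'} h => [|i'] h; first by rewrite mul0mx mxE.
  rewrite eqSS; case: leqP => hks; last first.
    by rewrite mul0mx mxE [_ == (s + k)%N]ltn_eqF ?andbF // ltn_addl.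
  rewrite (zr_dual zr); case: (eqVneq i' i) => [ei|]; rewrite ?andbF //.
  rewrite -(eqn_add2r k) subnK //; case: eqP => [es|]; rewrite ?andbF //.
  by rewrite (_ : in_range _ _ _ _) // ei es addnK.
Qed.

End ZRows.

Lemma gdual_gmod m n (M : gact F m n) : is_gmod M -> is_gmod (gdual M).
Proof.
have lieT (A B : 'M[F]_n) : lie (- A^T) (- B^T) = - (lie A B)^T.
  rewrite /lie !mulNmx !mulmxN !opprK -!trmx_mul [in RHS]linearB /= opprB.
  by [].
case=> hEH hFH hFE hX0 hX; split; rewrite /= ?lieT.
- by rewrite hEH linearZ /= scalerN.
- by rewrite hFH linearN linearZ /= scalerN.
- by rewrite hFE.
- by move=> j hj; rewrite hX0 // trmx0 oppr0.
move=> i j hj; rewrite !lieT; case: (hX i j hj) => -> -> -> ->; split=> //.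
- by rewrite linearZ /= scalerN.
- by rewrite linearZ /= scalerN.
- by rewrite trmx0 oppr0.
Qed.

Lemma zop_gdual m n (M : gact F m n) k : zop M k = - (zop (gdual M) k)^T.
Proof. by rewrite /zop /= scalerN linearN linearZ /= trmxK opprK. Qed.

Lemma trmxZ q r (c : F) (A : 'M[F]_(q, r)) : (c *: A)^T = c *: A^T.
Proof. exact: linearZ. Qed.

(* The basis of the dual module dual to [w], with the degrees reversed and
   signs making the action of [r] unsigned. *)
Lemma isZdual_graded_basis m n (M : gact F m n) al l : is_gmod M -> isZdual M al l ->
  exists Wc w ws, graded_basis M true l (fun i => al + (l - i) * m)%N Wc w ws.
Proof.
move=> hM /(isZ_zrows (gdual_gmod hM))[Wc0 [w [ws zr]]].
have gb := zrows_graded_basis zr.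
pose a i := (al + (l - i) * m)%N; pose a0 i := (al + i * m)%N.
pose wD i s : 'rV_n := if (i <= l)%N then (-1) ^+ i *: (ws (l - i)%N s)^T else 0.
pose wsD i s : 'cV_n := if (i <= l)%N then (-1) ^+ i *: (w (l - i)%N s)^T else 0.
have rng i s : (i <= l)%N -> in_range l a0 (l - i) s = in_range l a i s.
  by move=> hi; rewrite /in_range leq_subr hi.
have wDE i s : (i <= l)%N -> wD i s = (-1) ^+ i *: (ws (l - i)%N s)^T by rewrite /wD => ->.
have wsDE i s : (i <= l)%N -> wsD i s = (-1) ^+ i *: (w (l - i)%N s)^T by rewrite /wsD => ->.
have eE : gE M = - (gE (gdual M))^T by rewrite /= linearN /= trmxK opprK.
have eF : gF M = - (gF (gdual M))^T by rewrite /= linearN /= trmxK opprK.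
have eH : gH M = - (gH (gdual M))^T by rewrite /= linearN /= trmxK opprK.
have actw i s (A : 'M_n) : (i <= l)%N ->
    wD i s *m (- A^T) = - ((-1) ^+ i *: (A *m ws (l - i)%N s)^T).
  by move=> hi; rewrite wDE // mulmxN -scalemxAl -trmx_mul.
have actws i s (A : 'M_n) : (i <= l)%N ->
    - A^T *m wsD i s = - ((-1) ^+ i *: (w (l - i)%N s *m A)^T).
  by move=> hi; rewrite wsDE // mulNmx -scalemxAr -trmx_mul.
have dual i s i' s' : in_range l a i s -> in_range l a i' s' ->
    (wD i s *m wsD i' s') 0 0 = ((i == i') && (s == s'))%:R.
  move=> h h'; have [[hi hs] [hi' hs']] := (andP h, andP h').
  rewrite wDE // wsDE // -scalemxAl -scalemxAr -trmx_mul !mxE.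
  have := zr_dual zr (l - i')%N s' (l - i)%N s; rewrite mxE => ->.
  rewrite rng // h' /= [s' == s]eq_sym (_ : (l - i' == l - i)%N = (i == i')); last by lia.
  by case: eqP => [->|_] /=; rewrite ?mulr0 // mulrA -expr2 sqrr_sign mul1r.
pose Wc i := (\sum_(s < (a i).+1) <<wD i s>>)%MS.
exists Wc, wD, wsD; split=> //.
- by move=> i hi; rewrite -addnA -mulnDl subnK // subn0.
- move=> i hi; have ri : in_range l a i (a i) by rewrite /in_range hi /=.
  have ri0 : in_range l a0 (l - i) (a i) by rewrite rng.
  (* Dualising negates the weights, so the highest one sits at the last index s = a_i. *)
  apply: (highest_weight_iso hchar hM (v := wD i (a i))).
  + rewrite eE actw // (gb_E gb) // subnn scale0r trmx0 scaler0 oppr0 //.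
  + rewrite eH actw // (gb_H gb) // /hact trmxZ wDE // !scalerA -scaleNr; congr (_ *: _).
    by rewrite /a0 -/(a i) mul2n -addnn natrD; ring.
  + apply: contraTneq isT => e; have := dual _ _ _ _ ri ri.
    by rewrite e mul0mx mxE !eqxx => /esym/eqP; rewrite oner_eq0.
  + by rewrite (sumsmx_sup ord_max) ?genmxE.
  + rewrite /Wc sumsmxMr_gen; apply/sumsmx_subP => s _; rewrite genmxE.
    rewrite (eqmxMr _ (genmxE _)) eF actw // (gb_F gb) ?rng ?/in_range ?hi ?leq_ord //.
    rewrite trmxZ scalerA mulrC -scalerA -wDE // -scaleNr scalemx_sub //.
    have hs : (s.-1 < (a i).+1)%N by have := ltn_ord s; lia.
    by rewrite (sumsmx_sup (Ordinal hs)) ?genmxE.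
  + rewrite (leq_trans (mxrank_sum_leqif _)) //=.
    rewrite -[X in (_ <= X)%N]card_ord -sum1_card leq_sum // => e _.
    by rewrite mxrank_gen rank_leq_row.
- by move=> i hi; apply/eqmxP.
- move=> i s h; rewrite /wsD; case: ifP => // hi.
  by rewrite (zr_out zr) ?trmx0 ?scaler0 // (rng _ _ hi).
- rewrite -[RHS]trmx1 -(zr_id zr) (reindex_inj rev_ord_inj) /= linear_sum /=.
  apply: eq_bigr => i _; rewrite linear_sum /= subSS /= subKn ?leq_ord //.
  apply: eq_bigr => s _; rewrite trmx_mul wDE ?leq_subr // wsDE ?leq_subr // subKn ?leq_ord //.
  by rewrite -scalemxAl -scalemxAr scalerA -expr2 sqrr_sign scale1r.
- move=> i s h; have [hi hs] := andP h; rewrite eE actws // (zr_E zr) ?rng //.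
  case: s h hs => [|s] h hs; first by rewrite trmx0 !scaler0.
  rewrite trmxZ scalerA mulrC -scalerA -wsDE //; congr (- (_%:R *: _)).
  by move: hs; rewrite /= -/(a i); lia.
- move=> i s h; have [hi hs] := andP h; rewrite eF actws // (zr_F zr).
  by rewrite trmxZ scalerA mulrC -scalerA -wsDE.
- move=> i s h; have [hi hs] := andP h; rewrite eH actws // (zr_H zr).
  rewrite trmxZ scalerA mulrC -scalerA -wsDE // -scaleNr opprB //.
- move=> i s k h hk; have [hi hs] := andP h.
  rewrite zop_gdual actws // (zr_Z zr) ?leq_subr //.
  have [lt_i|ge_i] := ltnP i l; last first.
    have -> : (l - i)%N = 0%N by lia.
    by rewrite trmx0 scaler0 oppr0 /wsD ltnNge ge_i if_same.
  rewrite (_ : (l - i)%N = (l - i.+1).+1); last by lia.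
  case: ifP => _; last by rewrite trmx0 scaler0 oppr0.
  by rewrite wsDE // exprS mulN1r scaleNr.
Qed.

End FromIsZ.

(** * The socle series of a type Z module *)

Section SocleSeries.
Variables (F : fieldType) (m n : nat) (M : gact F m n).
Hypotheses (hchar : [pchar F] =i pred0) (hM : is_gmod M).
Variables (d : bool) (l : nat) (a : nat -> nat) (Wc : nat -> 'M[F]_n).
Variables (w : nat -> nat -> 'rV[F]_n) (ws : nat -> nat -> 'cV[F]_n).
Hypothesis gb : graded_basis M d l a Wc w ws.

Definition lower_part k : 'M[F]_n := (\sum_(i < l.+1 | (i < k)%N) Wc i)%MS.
Local Notation N := lower_part.

Lemma lower_partP k (x : 'rV_n) : reflect
  (forall i s, (k <= i)%N -> x *m ws i s = 0) (x <= N k)%MS.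
Proof.
apply: (iffP idP) => [xN i s le_ki|h].
  apply/eqP; rewrite -sub_kermx; apply: submx_trans xN _.
  apply/sumsmx_subP => j lt_jk; rewrite sub_kermx; apply/eqP.
  apply: (gb_sub_coord gb _ (leq_ord j) (submx_refl _)).
  by rewrite ltn_eqF // (leq_trans lt_jk).
rewrite (gb_expand gb x); apply: summx_sub => i _; apply: summx_sub => s _.
have [lt_ik|/h ->] := ltnP i k; last by rewrite mul0mx sub0mx.
rewrite (submx_trans (submxMl _ _)) // (sumsmx_sup i) //.
by apply: (gb_w_sub gb); apply: ord_in_range.
Qed.

Lemma lower_partS k : (k <= l)%N -> (N k.+1 :=: N k + Wc k)%MS.
Proof.
move=> hk; apply/eqmxP/andP; split.
  apply/sumsmx_subP => i; rewrite ltnS leq_eqVlt => /orP[/eqP ->|lt_i].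
    exact: addsmxSr.
  by apply: submx_trans (addsmxSl _ _); rewrite (sumsmx_sup i).
rewrite addsmx_sub; apply/andP; split.
  by apply/sumsmx_subP => i lt_i; rewrite (sumsmx_sup i) // ltnW.
exact: (sumsmx_sup (Ordinal (hk : k < l.+1)%N)).
Qed.

Lemma lower_part0 : N 0 = 0.
Proof. by rewrite /lower_part big_pred0. Qed.

Lemma lower_part_full k : (l < k)%N -> (N k :=: 1%:M)%MS.
Proof.
move=> hk; apply/eqmxP; rewrite submx1 /=; apply/row_subP => i; apply/lower_partP => j s hj.
by rewrite (gb_out gb) ?mulmx0 // /in_range; lia.
Qed.

Lemma rank_lower_partS k : (k <= l)%N -> \rank (N k.+1) = (\rank (N k) + (a k).+1)%N.
Proof.
move=> hk; rewrite (lower_partS hk) -(sl2_iso_irr_rank (gb_irr gb hk)).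
apply: mxrank_disjoint_sum; apply/eqP/rowV0P => x; rewrite sub_capmx => /andP[/lower_partP h hx].
rewrite (gb_expand gb x) big1 // => i _; rewrite big1 // => s _.
have [e|ne] := eqVneq (i : nat) k; first by rewrite h ?mul0mx // e.
by rewrite (gb_sub_coord gb _ hk hx) ?mul0mx // eq_sym.
Qed.

Lemma gsub_lower_part k : gsub M (N k).
Proof.
have st A : (forall i, (i <= l)%N -> stablemx (Wc i) A) -> stablemx (N k) A.
  move=> h; rewrite sumsmxMr_gen; apply/sumsmx_subP => i hi; rewrite genmxE.
  by apply: submx_trans (h i (leq_ord i)) _; rewrite (sumsmx_sup i).
have hs i hi := sl2_iso_irr_stable (@gb_irr _ _ _ _ _ _ _ _ _ _ gb i hi).
split; [apply: st => i /hs[]//|apply: st => i /hs[]//|apply: st => i /hs[]//|].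
move=> j; have [lt_mj|le_jm] := ltnP m j.
  by have [_ _ _ X0 _] := hM; rewrite X0 // mulmx0 sub0mx.
have zst k' : (k' <= m)%N -> stablemx (N k) (zop M k').
  move=> hk'; apply: stablemx_rows => x /lower_partP h; apply/lower_partP => i s hi.
  have [ri|/(gb_out gb) ->] := boolP (in_range l a i s); last by rewrite mulmx0.
  rewrite -mulmxA (gb_Z gb) //.
  by case: (d); rewrite ?h ?(leqW hi) //; case: ifP => _; rewrite ?mulmx0 // h // leqW.
have := zst (m - j)%N (leq_subr _ _); rewrite /zop subKn // -scalemxAr eqmx_scale //.
by rewrite mulf_eq0 signr_eq0 natr_eq0 // eqn0Ngt fact_gt0.
Qed.

(* Acting by [r] moves a vector of [Y] outside [N k] down to degree exactly
   [k], where irreducibility of [Wc k] takes over. *)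
Lemma gsub_lower_partS k Y : (k <= l)%N -> gsub M Y -> (N k <= Y)%MS -> ~~ (Y <= N k)%MS ->
  (N k.+1 <= Y)%MS.
Proof.
move=> hk [YE YF _ YX] NY nY.
suff [y [yY yN ynN]] : exists y : 'rV_n, [/\ (y <= Y)%MS, (y <= N k.+1)%MS & ~~ (y <= N k)%MS].
  rewrite (lower_partS hk) addsmx_sub NY /=.
  have := yN; rewrite (lower_partS hk) => /sub_addsmxP[[u1 u2] /= ey].
  have [B [_ /eqmxP BU hE hF _]] := gb_irr gb hk.
  have /submxP[x ex] : (u2 *m Wc k <= B)%MS by rewrite BU submxMl.
  rewrite -BU; apply: (irr_sub hchar hE hF YE YF (x := x)).
    apply: contraNneq ynN => x0; rewrite ey ex x0 mul0mx addr0.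
    exact: submxMl.
  rewrite -ex (_ : u2 *m _ = y - u1 *m N k); last by rewrite ey addrC addKr.
  by rewrite addmx_sub // eqmx_opp (submx_trans _ NY) // submxMl.
have [y yY ynN] : exists2 y : 'rV_n, (y <= Y)%MS & ~~ (y <= N k)%MS.
  have [i hi] := row_subPn nY; exists (row i Y) => //; exact: row_sub.
suff key j (x : 'rV_n) : (x <= Y)%MS -> ~~ (x <= N k)%MS -> (x <= N (k + j).+1)%MS ->
    exists y : 'rV_n, [/\ (y <= Y)%MS, (y <= N k.+1)%MS & ~~ (y <= N k)%MS].
  by apply: (key l y) => //; rewrite lower_part_full ?submx1 // ltnS leq_addl.
elim: j x => [|j IHj] x xY xn; first by rewrite addn0 => h; exists x.
have [xj _|xj xN] := boolP (x <= N (k + j).+1)%MS; first exact: IHj xj.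
have [s xs] : exists s, x *m ws (k + j).+1 s != 0.
  suff [s hs] : exists s : 'I_(a (k + j).+1).+1, x *m ws (k + j).+1 s != 0 by exists s.
  apply/existsP; apply: contraNT xj => /existsPn h; apply/lower_partP => i s.
  rewrite leq_eqVlt => /orP[/eqP <-|lt_i]; last first.
    by move/lower_partP: xN; apply; rewrite addnS.
  have [/andP[_ hs]|/(gb_out gb) ->] := boolP (in_range l a (k + j).+1 s); last by rewrite mulmx0.
  by apply/eqP; have := h (Ordinal (hs : s < (a (k + j).+1).+1)%N); rewrite negbK.
have [/andP[hl hs]|/(gb_out gb) e] := boolP (in_range l a (k + j).+1 s); last first.
  by rewrite e mulmx0 eqxx in xs.
have [s0 [k0 [r0 hk0 hz]]] : exists s0 k0, [/\ in_range l a (k + j) s0, (k0 <= m)%N &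
    zop M k0 *m ws (k + j)%N s0 = ws (k + j).+1 s].
  have e := chainS (gb_chain gb) hl; have hZ := gb_Z gb.
  move: e hZ hl hs; clear; move: (k + j)%N => i; case: d => /= e hZ hl hs.
    have r0 : in_range l a i s by rewrite /in_range; lia.
    exists s, 0%N; split; [exact: r0 | exact: leq0n |].
    by rewrite (hZ _ _ _ r0 (leq0n m)) subn0.
  have r0 : in_range l a i (minn s (a i)) by rewrite /in_range; lia.
  have hk0 : (s - minn s (a i) <= m)%N by lia.
  exists (minn s (a i)), (s - minn s (a i))%N; split; [exact: r0 | exact: hk0 |].
  by rewrite (hZ _ _ _ r0 hk0) subnKC // geq_minl.
apply: (IHj (x *m zop M k0)).
- rewrite /zop -scalemxAr scalemx_sub //; exact: submx_trans (submxMr _ xY) (YX _).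
- apply: contra xs => /lower_partP h; by rewrite -hz mulmxA h ?leq_addr.
apply/lower_partP => i s' hi.
have [ri|/(gb_out gb) ->] := boolP (in_range l a i s'); last by rewrite mulmx0.
move/lower_partP: xN => hx; rewrite -mulmxA (gb_Z gb) //.
have hi' : ((k + j.+1).+1 <= i.+1)%N by rewrite addnS.
by case: (d); rewrite ?hx //; case: ifP => _; rewrite ?mulmx0 // hx.
Qed.

Lemma gsub_eqmx (U U' : 'M[F]_n) : (U :=: U')%MS -> gsub M U -> gsub M U'.
Proof.
move=> e [hE hF hH hX].
by split=> [|||j]; rewrite -(eqmxMr _ e) -e.
Qed.

(** By [gsub_lower_partS] every submodule strictly above N k contains N k.+1. So there is exactly
    one simple submodule over N k, which is the uniseriality of M. *)
Lemma simple_lower_part k S : (k <= l)%N -> (S == N k)%MS ->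
  forall U, simple_over M S U <-> (U == N k.+1)%MS.
Proof.
move=> hk /eqmxP SN U; have rk := rank_lower_partS hk.
have NS : (N k <= N k.+1)%MS by rewrite (lower_partS hk) addsmxSl.
split=> [[gS gU]|/eqmxP UN].
  rewrite /ltmx !SN => /andP[SU nU] max.
  have NU := gsub_lower_partS hk gU SU nU.
  case: (max _ (gsub_lower_part k.+1)) => // [|/andP[h _]|/andP[_ h]].
  - by rewrite SN.
  - by move: (mxrankS h); rewrite SN rk; lia.
  - by rewrite h NU.
have nlt : ~~ (N k.+1 <= N k)%MS.
  by apply/negP => /mxrankS; rewrite rk; lia.
split.
- exact: gsub_eqmx (eqmx_sym SN) (gsub_lower_part k).
- exact: gsub_eqmx (eqmx_sym UN) (gsub_lower_part k.+1).
- by rewrite /ltmx !SN !UN NS nlt.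
move=> Y gY; rewrite !SN !UN => SY YU.
have [h|h] := boolP (Y <= N k)%MS; [left | right]; first by rewrite /= SY.
by rewrite YU gsub_lower_partS.
Qed.

Lemma is_sock_lower_part k T : is_sock M k T -> (T == N k)%MS.
Proof.
elim: k T => [|k IHk] T /=; first by rewrite lower_part0.
case=> S [/IHk SN [gT ST hU [q [Us [hUs /eqmxP TS]]]]].
have [hk|hk] := leqP k l; last first.
  have fN q' : (k <= q')%N -> (N q' :=: 1%:M)%MS.
    by move=> h; apply: lower_part_full; apply: leq_trans hk h.
  rewrite (fN k.+1) ?leqnSn // submx1 /=; apply: submx_trans ST.
  by rewrite (eqmx_trans (eqmxP SN) (fN k (leqnn k))) submx1.
have hs := simple_lower_part hk SN.
have NS : (N k <= N k.+1)%MS by rewrite (lower_partS hk) addsmxSl.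
apply/andP; split; last by apply: hU; apply/hs; apply/eqmxP.
rewrite TS addsmx_sub (eqmxP SN) NS /=; apply/sumsmx_subP => i _.
by have /hs/andP[] := hUs i.
Qed.

Lemma rank_sum_prefix (U : nat -> 'M[F]_n) q k : (k <= q)%N ->
  \rank (\sum_(i < q) U i)%MS = (\sum_(i < q) \rank (U i))%N ->
  \rank (\sum_(i < k) U i)%MS = (\sum_(i < k) \rank (U i))%N.
Proof.
elim: q => [|q IHq]; first by rewrite leqn0 => /eqP ->.
rewrite leq_eqVlt => /orP[/eqP -> //|le_k] h; apply: IHq => //.
apply/eqP; rewrite eqn_leq (mxrank_sum_leqif _) /=.
have := (mxrank_adds_leqif (\sum_(i < q) U i)%MS (U q)).1.
by move: h; rewrite !big_ord_recr /= => ->; rewrite leq_add2r.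
Qed.

Lemma casimir_coord i s : in_range l a i s ->
  casimir M *m ws i s = (a i * (a i).+2)%:R *: ws i s.
Proof.
move=> h; have [hi hs] := andP h.
rewrite /casimir !mulmxDl -!scalemxAl -!mulmxA (gb_F gb) // (gb_H gb) // -!scalemxAr (gb_H gb) //.
have := gb_E gb; case: (d) => hE.
  have -> : gE M *m - (s.+1%:R *: ws i s.+1) = (s.+1 * (a i - s))%:R *: ws i s.
    rewrite mulmxN -scalemxAr; have [h1|h1] := boolP (in_range l a i s.+1).
      rewrite hE // scalerN opprK scalerA -natrM; congr (_%:R *: _).
      by case/andP: h1 => _ lt_s; rewrite /= addn1 subnSK.
    rewrite (gb_out gb) // mulmx0 scaler0 oppr0 (_ : (_ - _)%N = 0%N) ?muln0 ?scale0r //.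
    by move: h1; rewrite /in_range; lia.
  by rewrite !scalerA -!scalerDl; congr (_ *: _); rewrite /hact natrM natrB //; ring.
have -> : gE M *m (s%:R *: ws i s.-1) = (s * (a i - s + 1))%:R *: ws i s.
  case: s h hs => [|s] h hs; first by rewrite scale0r mulmx0 ?mul0n ?scale0r.
  rewrite -scalemxAr /= hE ?scalerA -?natrM; last by rewrite /in_range hi ltnW.
  by rewrite addn1 subnSK.
by rewrite !scalerA -!scalerDl; congr (_ *: _); rewrite /hact natrM natrD natrB //; ring.
Qed.

Hypothesis hm : (1 <= m)%N.

Lemma chain_inj i j : (i <= l)%N -> (j <= l)%N -> a i = a j -> i = j.
Proof.
move=> hi hj; have := gb_chain gb hi; have := gb_chain gb hj; case: (d) => e e' ea.
  by apply/eqP; rewrite -(eqn_pmul2r hm); apply/eqP; lia.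
by apply/eqP; rewrite -(eqn_pmul2r hm); apply/eqP; lia.
Qed.

(** The a_i are distinct, so [Wc i] is a full Casimir eigenspace and M contains no other copy of
    V(a_i). *)
Lemma irr_eq_component i (U : 'M_n) : (i <= l)%N -> sl2_iso_irr M U (a i) -> (U == Wc i)%MS.
Proof.
move=> hi hU.
have UW : (U <= Wc i)%MS.
  apply/row_subP => q; set u := row q U.
  have uC : u *m casimir M = (a i * (a i).+2)%:R *: u.
    by rewrite /u -row_mul (casimir_irr hU) linearZ.
  have u0 j s : j != i -> u *m ws j s = 0.
    move=> ne; have [h|/(gb_out gb) ->] := boolP (in_range l a j s); last by rewrite mulmx0.
    have := congr1 (mulmx^~ (ws j s)) uC; rewrite -mulmxA casimir_coord // -scalemxAr -scalemxAl.
    move/eqP; rewrite -subr_eq0 -scalerBl scaler_eq0 subr_eq0 => /orP[/eqP/(natr_inj hchar) e|/eqP //].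
    have [hj _] := andP h; case/eqP: ne; apply: chain_inj => //.
    by have [//|lt|lt] := ltngtP (a j) (a i); nia.
  rewrite (gb_expand gb u); apply: summx_sub => j _; apply: summx_sub => s _.
  have [e|/u0 ->] := eqVneq (j : nat) i; last by rewrite mul0mx sub0mx.
  rewrite (submx_trans (submxMl _ _)) // -e; apply: (gb_w_sub gb).
  exact: ord_in_range.
by rewrite -(mxrank_leqif_eq UW) (sl2_iso_irr_rank hU) (sl2_iso_irr_rank (gb_irr gb hi)).
Qed.

(** The k-th socle is N k for any decomposition; its ranks give the length and the weights, and
    [irr_eq_component] the components. *)
Lemma socle_decomp_component l1 a1 (Vc : nat -> 'M_n) : socle_decomp M l1 a1 Vc ->
  l1 = l /\ forall i, (i <= l)%N -> a1 i = a i /\ (Vc i == Wc i)%MS.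
Proof.
case=> hirr hfull hrank hsock.
have pre k : (k <= l1.+1)%N -> \rank (N k) = (\sum_(i < k) (a1 i).+1)%N.
  move=> hk; rewrite -(eqmxP (is_sock_lower_part (hsock k hk))) (rank_sum_prefix hk).
    apply: eq_bigr => i _; apply: (sl2_iso_irr_rank (hirr i _)).
    by have := ltn_ord i; lia.
  by rewrite (eqmxP hfull) hrank.
have preS k : (k <= l1)%N -> \rank (N k.+1) = (\rank (N k) + (a1 k).+1)%N.
  by move=> hk; rewrite !pre // ?big_ord_recr //= ltnW.
have ea i : (i <= l1)%N -> (i <= l)%N -> a1 i = a i.
  by move=> h1 h; have := preS i h1; rewrite rank_lower_partS //; lia.
have le1 : (l1 <= l)%N.
  rewrite leqNgt; apply/negP => h; have := preS _ h.
  by rewrite !lower_part_full // mxrank1; lia.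
have le2 : (l <= l1)%N.
  rewrite leqNgt; apply/negP => h; have := rank_lower_partS h.
  rewrite -[in RHS](eqmxP (is_sock_lower_part (hsock _ (leqnn _)))) (eqmxP hfull).
  by have := rank_leq_col (N l1.+2); rewrite mxrank1; lia.
have el : l1 = l by lia.
split=> // i hi; have e := ea i ltac:(lia) hi; split=> //.
by apply: irr_eq_component; rewrite // -e; apply: hirr; lia.
Qed.

End SocleSeries.

(** * Transfer to a given socle decomposition *)

Section FromSocleDecomposition.
Variables (F : fieldType) (m n : nat) (M : gact F m n).
Hypotheses (hchar : [pchar F] =i pred0) (hm : (1 <= m)%N) (hM : is_gmod M).

Lemma graded_basis_socle d l a Wc w ws l1 a1 (Vc : nat -> 'M_n) :
  graded_basis M d l a Wc w ws -> socle_decomp M l1 a1 Vc ->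
  graded_basis M d l1 a1 Vc w ws.
Proof.
move=> gb hd; have [-> e] := socle_decomp_component hchar hM gb hm hd.
have ea i : (i <= l)%N -> a1 i = a i by case/e.
have rng i s : in_range l a1 i s = in_range l a i s.
  by rewrite /in_range; have [/ea ->|] := leqP i l.
split.
- by move=> i hi; rewrite !ea //; apply: (gb_chain gb).
- move=> i hi; have [-> /andP[h1 h2]] := e i hi.
  by apply: sl2_iso_irr_eqmx (gb_irr gb hi); rewrite h1 h2.
- move=> i hi; have [-> /eqmxP h] := e i hi.
  by apply/eqmxP; apply: eqmx_trans h (eqmxP (gb_span gb hi)).
- by move=> i s; rewrite rng; apply: (gb_out gb).
- by move=> i s i' s'; rewrite !rng; apply: (gb_dual gb).
- rewrite -(gb_id gb); apply: eq_bigr => i _.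
  by rewrite ea ?leq_ord.
- by move=> i s; rewrite rng => h; rewrite ea; [apply: (gb_E gb) | case/andP: h].
- by move=> i s; rewrite rng; apply: (gb_F gb).
- by move=> i s; rewrite rng => h; rewrite ea; [apply: (gb_H gb) | case/andP: h].
- by move=> i s k; rewrite rng; apply: (gb_Z gb).
Qed.

Lemma isZ_socle_basis al l0 l a Vc : isZ M al l0 -> socle_decomp M l a Vc ->
  exists w ws, graded_basis M false l a Vc w ws.
Proof.
move=> /(isZ_zrows hchar hM)[Wc [w [ws zr]]] hd; exists w, ws.
exact: graded_basis_socle (zrows_graded_basis zr) hd.
Qed.

Lemma isZdual_socle_basis al l0 l a Vc : isZdual M al l0 -> socle_decomp M l a Vc ->
  exists w ws, graded_basis M true l a Vc w ws.
Proof.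
move=> /(isZdual_graded_basis hchar hM)[Wc [w [ws gb]]] hd; exists w, ws.
exact: graded_basis_socle gb hd.
Qed.

Lemma is_soc_socle d l a Vc w ws socM : graded_basis M d l a Vc w ws -> is_soc M socM ->
  (socM == Vc 0%N)%MS.
Proof.
move=> gb /(is_sock_lower_part hchar hM gb) e; apply/eqmxP; apply: eqmx_trans (eqmxP e) _.
apply: eqmx_trans (lower_partS Vc (leq0n l)) _; rewrite lower_part0; exact: adds0mx.
Qed.

End FromSocleDecomposition.

(** * Lists of highest weights and the three cases *)

Section Lists.
Local Open Scope nat_scope.
Implicit Types a b m L : nat.

Lemma uniq_cat_disjoint (s1 s2 : seq nat) : uniq s1 -> uniq s2 ->
  (forall c, c \in s1 -> c \in s2 -> False) -> uniq (s1 ++ s2).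
Proof.
move=> u1 u2 h; rewrite cat_uniq u1 u2 andbT; apply/hasPn => c h2.
by apply/negP => h1; apply: h h1 h2.
Qed.

Lemma uniq_hankel_list a b m L : 0 < m ->
  uniq ([seq a + b - 2 * k | k <- iota 0 (minn a b).+1] ++ [seq a + b + m * t | t <- iota 1 L]).
Proof.
move=> hm; apply: uniq_cat_disjoint; first exact: uniq_clebsch_gordan.
  rewrite map_inj_in_uniq ?iota_uniq // => i j _ _ /addnI/eqP.
  by rewrite eqn_pmul2l // => /eqP.
move=> _ /mapP[k _ ->] /mapP[t]; rewrite mem_iota => /andP[t1 _].
by have := leq_mul hm t1; lia.
Qed.

(** The second list is nonempty only if a <= b, and its entries are below b - a, the least
    Clebsch-Gordan weight. *)
Lemma uniq_mixed_list a b m L : 0 < m ->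
  uniq ([seq a + b - 2 * k | k <- iota 0 (minn a b).+1] ++
        [seq b - a - t * m | t <- iota 1 L & a + t * m <= b]).
Proof.
move=> hm; apply: uniq_cat_disjoint; first exact: uniq_clebsch_gordan.
  rewrite map_inj_in_uniq ?filter_uniq ?iota_uniq // => i j; rewrite !mem_filter.
  by move=> /andP[hi _] /andP[hj _] e; apply/eqP; rewrite -(eqn_pmul2r hm); apply/eqP; lia.
move=> _ /mapP[k + ->] /mapP[t]; rewrite mem_filter !mem_iota => hk /andP[le_t /andP[t1 _]].
by have := leq_mul t1 hm; lia.
Qed.

Lemma perm_clebsch_gordan a b :
  perm_eq [seq maxn a b - minn a b + 2 * k | k <- iota 0 (minn a b).+1]
          [seq a + b - 2 * k | k <- iota 0 (minn a b).+1].
Proof.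
apply: uniq_perm; last 1 first.
- move=> c; apply/mapP/mapP => -[k]; rewrite mem_iota => hk ->;
    by exists (minn a b - k); rewrite ?mem_iota; lia.
- by rewrite map_inj_in_uniq ?iota_uniq // => i j _ _; lia.
- exact: uniq_clebsch_gordan.
Qed.

Lemma perm_mixed (D : nat -> nat) a b m L : 0 < m -> a <= b ->
  perm_eq [seq D t | t <- iota 1 (minn L ((b - a) %/ m))]
          [seq D t | t <- iota 1 L & a + t * m <= b].
Proof.
move=> hm le_ab; apply/perm_map/uniq_perm; rewrite ?filter_uniq ?iota_uniq // => t.
rewrite mem_filter !mem_iota add1n ltnS leq_min leq_divRL //.
case: t => [|t]; first by rewrite andbF.
by rewrite /= andbC add1n ltnS; congr (_ && _); lia.
Qed.

End Lists.

(** * The socle for each pair of types *)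

Section TypeZ.
Variables (F : fieldType) (m n p : nat) (V : gact F m n) (W : gact F m p).
Hypotheses (hchar : [pchar F] =i pred0) (hm : (1 <= m)%N).
Hypotheses (hV : is_gmod V) (hW : is_gmod W).
Variables (l l' : nat) (a b : nat -> nat).
Variables (Vc : nat -> 'M[F]_n) (Wc : nat -> 'M[F]_p).
Variables (w : nat -> nat -> 'rV[F]_n) (ws : nat -> nat -> 'cV[F]_n).
Variables (v : nat -> nat -> 'rV[F]_p) (vs : nat -> nat -> 'cV[F]_p).
Local Notation T := (gtens V W).
Local Notation L := (minn l l').
Local Notation S := (S_t V W l l' Vc Wc).

Lemma chain_dual_weight c (e : nat -> nat) q t : chain m true q e -> (t <= q)%N ->
  (e t - c = e 0 - c - t * m)%N /\ (c <= e t)%N = (c + t * m <= e 0)%N.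
Proof. by move=> ch ht; have := ch t ht; lia. Qed.

Section Hankel.
Hypotheses (gV : graded_basis V false l a Vc w ws) (gW : graded_basis W false l' b Wc v vs).

Lemma S_hankel t : (1 <= t <= L)%N -> sl2_iso_irr T (S t) (a 0%N + b 0%N + m * t).
Proof.
case/andP=> t1 tL; apply: (S_t_irr hchar hV hW gV gW).
exact: (irr_degree_hankel F hm (gb_chain gV) (gb_chain gW) t1 tL).
Qed.

Lemma soc_hankel socT : is_soc T socT -> sl2_iso_sum T socT
  ([seq (a 0%N + b 0%N - 2 * k)%N | k <- iota 0 (minn (a 0%N) (b 0%N)).+1]
   ++ [seq (a 0%N + b 0%N + m * t)%N | t <- iota 1 L]).
Proof.
apply: (soc_tens_iso_sum hchar hm hV hW gV gW (P := predT)
  (D := fun t => a 0 + b 0 + m * t)%N) => // [t ht _||].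
- exact: S_hankel.
- exact: uniq_hankel_list.
- by rewrite filter_predT.
Qed.
End Hankel.

Section Mixed.
Hypotheses (gV : graded_basis V false l a Vc w ws) (gW : graded_basis W true l' b Wc v vs).

Lemma S_mixed t : (1 <= t <= L)%N -> (a 0 <= b t)%N ->
  sl2_iso_irr T (S t) (b 0%N - a 0%N - t * m).
Proof.
case/andP=> t1 tL h; have ht : (t <= l')%N by lia.
rewrite -(chain_dual_weight (a 0%N) (gb_chain gW) ht).1.
apply: (S_t_irr hchar hV hW gV gW).
exact: (irr_degree_mixed F hm (gb_chain gV) (gb_chain gW) t1 tL h).
Qed.

Lemma S_mixed_eq0 t : (1 <= t <= L)%N -> (b t < a 0)%N -> (S t == (0 : 'M_(n * p)))%MS.
Proof.
case/andP=> t1 tL h; apply: (S_t_zero hchar hV hW gV gW).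
exact: (zero_degree_mixed hm (gb_chain gV) (gb_chain gW) t1 tL h).
Qed.

(** The filter a_0 + tm <= b_0 is the condition a_0 <= b_t; it covers both alternatives of (ii),
    being empty when a_0 > b_0. *)
Lemma soc_mixed socT s : is_soc T socT -> 
  perm_eq s ([seq (a 0%N + b 0%N - 2 * k)%N | k <- iota 0 (minn (a 0%N) (b 0%N)).+1] ++
        [seq (b 0 - a 0 - t * m)%N | t <- iota 1 L & (a 0 + t * m <= b 0)%N]) ->
  sl2_iso_sum T socT s.
Proof.
move=> hs es; apply: (soc_tens_iso_sum hchar hm hV hW gV gW _ _ _ es hs) => [t ht|t ht|].
- rewrite -(chain_dual_weight _ (gb_chain gW) (_ : t <= l')%N).2; last by lia.
  exact: S_mixed.
- rewrite -(chain_dual_weight _ (gb_chain gW) (_ : t <= l')%N).2; last by lia.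
  by rewrite -ltnNge => /(S_mixed_eq0 ht)/andP[h _]; apply/eqP; rewrite -submx0.
- by rewrite (perm_uniq es) uniq_mixed_list.
Qed.
End Mixed.

Section MixedSwap.
Hypotheses (gV : graded_basis V true l a Vc w ws) (gW : graded_basis W false l' b Wc v vs).

(** The order Z^* (x) Z is not among (i) to (iii), but multiplicity freeness includes it; the
    weights are those of W (x) V. *)
Lemma soc_mixed_swap socT : is_soc T socT -> exists s, uniq s /\ sl2_iso_sum T socT s.
Proof.
move=> hs; exists ([seq (b 0%N + a 0%N - 2 * k)%N | k <- iota 0 (minn (b 0%N) (a 0%N)).+1] ++
        [seq (a 0 - b 0 - t * m)%N | t <- iota 1 L & (b 0 + t * m <= a 0)%N]).
have us := uniq_mixed_list (b 0%N) (a 0%N) L hm; split=> //.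
apply: (soc_tens_iso_sum hchar hm hV hW gV gW _ _ us _ hs); last first.
  by rewrite [(b 0 + a 0)%N]addnC minnC; apply: perm_refl.
- move=> t /andP[t1 tL]; have ht : (t <= l)%N by lia.
  have [ew ec] := chain_dual_weight (b 0%N) (gb_chain gV) ht.
  rewrite -ec => h; apply/eqP; rewrite -submx0.
  have tL' : (t <= minn l' l)%N by rewrite minnC.
  suff /andP[] // : (S t == (0 : 'M_(n * p)))%MS by [].
  apply: (S_t_zero hchar hV hW gV gW); apply: zero_degree_swap.
  by apply: (zero_degree_mixed hm (gb_chain gW) (gb_chain gV)) t1 tL' _; rewrite ltnNge.
- move=> t /andP[t1 tL]; have ht : (t <= l)%N by lia.
  have [ew ec] := chain_dual_weight (b 0%N) (gb_chain gV) ht.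
  rewrite -ec -ew => h.
  have tL' : (t <= minn l' l)%N by rewrite minnC.
  apply: (S_t_irr hchar hV hW gV gW); apply: irr_degree_swap.
  exact: (irr_degree_mixed F hm (gb_chain gW) (gb_chain gV) t1 tL' h).
Qed.
End MixedSwap.

Section Dual.
Hypotheses (gV : graded_basis V true l a Vc w ws) (gW : graded_basis W true l' b Wc v vs).

Lemma S_dual_eq0 t : (1 <= t)%N -> (S t == (0 : 'M_(n * p)))%MS.
Proof.
move=> t1; apply: (S_t_zero hchar hV hW gV gW).
exact: (zero_degree_dual hm (gb_chain gV) (gb_chain gW) t1).
Qed.

Lemma soc_dual socT : is_soc T socT -> sl2_iso_sum T socT
  [seq (maxn (a 0%N) (b 0%N) - minn (a 0%N) (b 0%N) + 2 * k)%N
     | k <- iota 0 (minn (a 0%N) (b 0%N)).+1].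
Proof.
have ep := perm_clebsch_gordan (a 0%N) (b 0%N).
apply: (soc_tens_iso_sum hchar hm hV hW gV gW (P := pred0) (D := id)) => // [t ht _||].
- by have /andP[h _] := S_dual_eq0 (andP ht).1; apply/eqP; rewrite -submx0.
- by rewrite (perm_uniq ep) uniq_clebsch_gordan.
- by rewrite filter_pred0 cats0.
Qed.
End Dual.

End TypeZ.

Unset Implicit Arguments.

Theorem theorem3p5 (F : fieldType) (hchar : [pchar F] =i pred0)
  (m n p : nat) (hm : (1 <= m)%N)
  (V : gact F m n) (W : gact F m p)
  (hV : is_gmod V) (hW : is_gmod W) (hZV : typeZ V) (hZW : typeZ W)
  (l l' : nat) (a b : nat -> nat)
  (Vc : nat -> 'M[F]_n) (Wc : nat -> 'M[F]_p)
  (hdV : socle_decomp V l a Vc) (hdW : socle_decomp W l' b Wc) :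
  let S := S_t V W l l' Vc Wc in
  let L := minn l l' in
  (* soc(V (x) W) = soc(V) (x) soc(W) (+) (+)_{t=1}^{min} S_t *)
  (forall (socV : 'M[F]_n) (socW : 'M[F]_p) (socT : 'M[F]_(n * p)),
     is_soc V socV -> is_soc W socW -> is_soc (gtens V W) socT ->
     (socT == socV *t socW + \sum_(1 <= t < L.+1) S t)%MS /\
     \rank socT = (\rank (socV *t socW) + \sum_(1 <= t < L.+1) \rank (S t))%N)
  /\
  (* (i) *)
  (isZ V (a 0%N) l -> isZ W (b 0%N) l' ->
     (forall t, (1 <= t <= L)%N ->
        sl2_iso_irr (gtens V W) (S t) (a 0%N + b 0%N + m * t)) /\
     (forall socT, is_soc (gtens V W) socT ->
        sl2_iso_sum (gtens V W) socT
          ([seq (a 0%N + b 0%N - 2 * k)%N | k <- iota 0 (minn (a 0%N) (b 0%N)).+1]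
           ++ [seq (a 0%N + b 0%N + m * t)%N | t <- iota 1 L])))
  /\
  (* (ii) *)
  (isZ V (a 0%N) l -> isZdual W (b l') l' ->
     (forall t, (1 <= t <= L)%N ->
        (b t < a 0%N)%N -> (S t == (0 : 'M[F]_(n * p)))%MS) /\
     (forall t, (1 <= t <= L)%N ->
        (a 0%N <= b t)%N -> sl2_iso_irr (gtens V W) (S t) (b 0%N - a 0%N - t * m)) /\
     (forall socT, is_soc (gtens V W) socT ->
        ((b 0%N < a 0%N)%N ->
           sl2_iso_sum (gtens V W) socT
             [seq (a 0%N - b 0%N + 2 * k)%N | k <- iota 0 (b 0%N).+1]) /\
        ((a 0%N <= b 0%N)%N ->
           sl2_iso_sum (gtens V W) socT
             ([seq (b 0%N - a 0%N + 2 * k)%N | k <- iota 0 (a 0%N).+1]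
              ++ [seq (b 0%N - a 0%N - t * m)%N
                   | t <- iota 1 (minn L ((b 0%N - a 0%N) %/ m))]))))
  /\
  (* (iii) *)
  (isZdual V (a l) l -> isZdual W (b l') l' ->
     (forall t, (1 <= t)%N -> (S t == (0 : 'M[F]_(n * p)))%MS) /\
     (forall socT, is_soc (gtens V W) socT ->
        sl2_iso_sum (gtens V W) socT
          [seq (maxn (a 0%N) (b 0%N) - minn (a 0%N) (b 0%N) + 2 * k)%N
             | k <- iota 0 (minn (a 0%N) (b 0%N)).+1]))
  /\
  (* multiplicity free *)
  (forall socT, is_soc (gtens V W) socT ->
     exists s : seq nat, uniq s /\ sl2_iso_sum (gtens V W) socT s).
Proof.
move=> S L.
(* [typeZ] provides parameters a priori unrelated to l and a; the given socle decomposition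
   reconciles them. *)
have bV : exists d w ws, graded_basis V d l a Vc w ws.
  case: hZV => al [l0 [/(isZ_socle_basis hchar hm hV) h | /(isZdual_socle_basis hchar hm hV) h]].
    by exists false; apply: h.
  by exists true; apply: h.
have bW : exists d w ws, graded_basis W d l' b Wc w ws.
  case: hZW => al [l0 [/(isZ_socle_basis hchar hm hW) h | /(isZdual_socle_basis hchar hm hW) h]].
    by exists false; apply: h.
  by exists true; apply: h.
split; last split; last split; last split.
- move=> socV socW socT sV sW sT.
  have [d [w [ws gV]]] := bV; have [d' [v [vs gW]]] := bW.
  have [eT rT] := soc_tens_sum hchar hm hV hW gV gW sT.
  have /eqmxP eV := is_soc_socle hchar hV gV sV; have /eqmxP eW := is_soc_socle hchar hW gW sW.
  have e0 : (S_t V W l l' Vc Wc 0 :=: socV *t socW)%MS.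
    apply: eqmx_trans (eqmxP (S_t_0 hchar hV hW gV gW)) _; apply/eqmxP/andP.
    by split; apply: tensmxS; rewrite ?eV ?eW.
  rewrite !big_add1 !big_mkord /=; split; last by rewrite rT big_ord_recl e0.
  apply/eqmxP; apply: eqmx_trans (eqmxP eT) _; rewrite big_ord_recl /=.
  exact: adds_eqmx e0 (eqmx_refl _).
- move=> /(isZ_socle_basis hchar hm hV)/(_ hdV)[w [ws gV]].
  move=> /(isZ_socle_basis hchar hm hW)/(_ hdW)[v [vs gW]].
  split; first exact: (S_hankel hchar hm hV hW gV gW).
  exact: (soc_hankel hchar hm hV hW gV gW).
- move=> /(isZ_socle_basis hchar hm hV)/(_ hdV)[w [ws gV]].
  move=> /(isZdual_socle_basis hchar hm hW)/(_ hdW)[v [vs gW]].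
  split; first exact: (S_mixed_eq0 hchar hm hV hW gV gW).
  split; first exact: (S_mixed hchar hm hV hW gV gW).
  move=> socT sT; have ep := perm_clebsch_gordan (a 0%N) (b 0%N).
  split=> hab; apply: (soc_mixed hchar hm hV hW gV gW sT).
    rewrite -[X in perm_eq X]cats0; apply: perm_cat.
      by move: ep; rewrite (maxn_idPl (ltnW hab)) (minn_idPr (ltnW hab)).
    by rewrite (eq_filter (a2 := pred0)) ?filter_pred0 // => t; apply/negbTE; rewrite -ltnNge; lia.
  apply: perm_cat; last exact: perm_mixed.
  by move: ep; rewrite (maxn_idPr hab) (minn_idPl hab).
- move=> /(isZdual_socle_basis hchar hm hV)/(_ hdV)[w [ws gV]].
  move=> /(isZdual_socle_basis hchar hm hW)/(_ hdW)[v [vs gW]].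
  split; first exact: (S_dual_eq0 hchar hm hV hW gV gW).
  exact: (soc_dual hchar hm hV hW gV gW).
move=> socT sT; have [d [w [ws gV]]] := bV; have [d' [v [vs gW]]] := bW.
case: d gV => gV; case: d' gW => gW.
- exists [seq (maxn (a 0%N) (b 0%N) - minn (a 0%N) (b 0%N) + 2 * k)%N
     | k <- iota 0 (minn (a 0%N) (b 0%N)).+1].
  split; last exact: (soc_dual hchar hm hV hW gV gW sT).
  by rewrite (perm_uniq (perm_clebsch_gordan _ _)) uniq_clebsch_gordan.
- exact: (soc_mixed_swap hchar hm hV hW gV gW sT).
- eexists; split; last exact: (soc_mixed hchar hm hV hW gV gW sT (perm_refl _)).
  exact: uniq_mixed_list.
- eexists; split; last exact: (soc_hankel hchar hm hV hW gV gW sT).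
  exact: uniq_hankel_list.
Qed.
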